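(* Let $K$ be an algebraically closed field of characteristic $p>0$, let $s\ge 1$ be an integer, and let $n=sp+1$. Then the $a$-number of the Hurwitz curve $\mathcal{H}_{sp+1}$ over $K$ is $$a(\mathcal{H}_{sp+1})=\tfrac14\, s(s-1)p(p-1).$$
   Context: For a positive integer $n$ with $p\nmid n^2-n+1$, the Hurwitz curve $\mathcal{H}_n$ is the nonsingular projective plane curve over $K$ with affine equation $X^nY+Y^n+X=0$ (it has degree $n+1$). For a (projective, irreducible, nonsingular) curve $\mathcal{X}$ over $K$ with separating variable $x$ (i.e. $x\in K(\mathcal{X})\setminus K(\mathcal{X})^p$), every $f\in K(\mathcal{X})$ is uniquely $f=u_0^p+u_1^px+\dots+u_{p-1}^px^{p-1}$ with $u_i\in K(\mathcal{X})$; the Cartier operator is the $1/p$-linear map $\mathcal{C}(f\,dx)=u_{p-1}\,dx$ on differentials (it does not depend on $x$). It maps the $g$-dimensional $K$-space $H^0(\mathcal{X},\Omega^1)$ of holomorphic differentials into itself, where $g$ is the genus. The $a$-number $a(\mathcal{X})$ is the $K$-dimension of the kernel of $\mathcal{C}$ on $H^0(\mathcal{X},\Omega^1)$, equivalently the dimension of the space of exact holomorphic differentials (those of the form $df$, $f\in K(\mathcal{X})$). *)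

(* Defs.v *)
From HB Require Import structures.
From mathcomp Require Import all_boot all_order all_algebra.
From mathcomp Require Import mpoly.

Set Implicit Arguments.
Unset Strict Implicit.
Unset Printing Implicit Defensive.

Import GRing.Theory.
Local Open Scope ring_scope.

Section PlaneCurve.

Variables (K L : fieldType) (iota : {rmorphism K -> L}).

(* A plane projective curve is given by a homogeneous F in K[X, Y, Z]; the
   elements x, y of L stand for the rational functions X / Z and Y / Z, so that
   heval x y A is the value of A at the generic point (x : y : 1). *)
Definition heval (x y : L) (A : {mpoly K[3]}) : L :=
  mmap iota (fun i : 'I_3 => [:: x; y; 1]`_i) A.

(* L is the function field of the curve F = 0, with coordinate functions x and
   y: a form vanishes at (x : y : 1) iff F divides it, and the elements of L are
   the quotients of two forms of the same degree. Such (L, x, y) is unique up to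
   isomorphism over K, and exists when F is irreducible and Z does not vanish
   identically on the curve. *)
Definition function_field (F : {mpoly K[3]}) (x y : L) : Prop :=
  (forall (e : nat) (A : {mpoly K[3]}), A \is e.-homog ->
     (heval x y A = 0 <-> exists Q : {mpoly K[3]}, A = Q * F))
  /\
  (forall f : L, exists (e : nat) (A B : {mpoly K[3]}),
     [/\ A \is e.-homog, B \is e.-homog, heval x y B != 0
       & f = heval x y A / heval x y B]).

(* P is a vector of homogeneous coordinates of a point of the curve F = 0. *)
Definition on_curve (F : {mpoly K[3]}) (P : 'I_3 -> K) : Prop :=
  (exists i, P i != 0) /\ F.@[P] = 0.

(* Membership in the local ring at P. When P lies on F = 0, the condition
   B.@[P] != 0 forces F not to divide B, hence heval x y B != 0. *)
Definition regular_at (x y : L) (P : 'I_3 -> K) (f : L) : Prop :=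
  exists (e : nat) (A B : {mpoly K[3]}),
    [/\ A \is e.-homog, B \is e.-homog, B.@[P] != 0
      & f = heval x y A / heval x y B].

Definition derivation (M : lmodType L) (D : L -> M) : Prop :=
  [/\ forall f g, D (f + g) = D f + D g,
      forall f g, D (f * g) = f *: D g + g *: D f
    & forall c : K, D (iota c) = 0].

(* (Omega, d) is the module of Kaehler differentials of L over K. *)
Definition kaehler (Omega : lmodType L) (d : L -> Omega) : Prop :=
  derivation d /\
  forall (M : lmodType L) (D : L -> M), derivation D ->
    exists phi : {linear Omega -> M},
      (forall f, phi (d f) = D f) /\
      (forall psi : {linear Omega -> M},
         (forall f, psi (d f) = D f) -> psi =1 phi).

Variables (Omega : lmodType L) (d : L -> Omega).

(* omega is regular at P when it comes from a differential of the local ring. *)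
Definition regular_diff_at (x y : L) (P : 'I_3 -> K) (omega : Omega) : Prop :=
  exists (m : nat) (g t : 'I_m -> L),
    [/\ forall i, regular_at x y P (g i),
        forall i, regular_at x y P (t i)
      & omega = \sum_(i < m) g i *: d (t i)].

Definition holomorphic (F : {mpoly K[3]}) (x y : L) (omega : Omega) : Prop :=
  forall P : 'I_3 -> K, on_curve F P -> regular_diff_at x y P omega.

Definition separating (p : nat) (z : L) : Prop :=
  ~ exists w : L, z = w ^+ p.

(* The graph of the Cartier operator: cartier p omega eta means that
   C(omega) = eta. The value does not depend on the separating variable z. *)
Definition cartier (p : nat) (omega eta : Omega) : Prop :=
  exists (z : L) (u : nat -> L),
    [/\ separating p z,
        omega = (\sum_(i < p) u i ^+ p * z ^+ i) *: d z
      & eta = u p.-1 *: d z].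

(* S is a K-subspace of Omega of dimension r (K acts on Omega through iota). *)
Definition has_Kdim (S : Omega -> Prop) (r : nat) : Prop :=
  exists e : 'I_r -> Omega,
    (forall omega, S omega <->
       exists c : 'I_r -> K, omega = \sum_(i < r) iota (c i) *: e i)
    /\
    (forall c : 'I_r -> K,
       \sum_(i < r) iota (c i) *: e i = 0 -> forall i, c i = 0).

Definition a_number (p : nat) (F : {mpoly K[3]}) (x y : L) (a : nat) : Prop :=
  has_Kdim (fun omega => holomorphic F x y omega /\ cartier p omega 0) a.

End PlaneCurve.

(* The homogenization X^n Y + Y^n Z + Z^n X of X^n Y + Y^n + X. *)
Definition hurwitz (K : fieldType) (n : nat) : {mpoly K[3]} :=
  'X_0 ^+ n * 'X_1 + 'X_1 ^+ n * 'X_2 + 'X_2 ^+ n * 'X_0.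

(* Main.v *)
(* With k = s p, the holomorphic differentials are g w0, where w0 = dx / f_y
   and g is a polynomial in x, y of degree at most k - 1. Put v = 1 / x. The
   equation of the curve reads 1 / y = - (x^k + y^k v), and w0 = x y dv; hence,
   writing i = i1 p + i0 and j = j1 p + j0,
     x^i y^j w0
       = (x^(i1+1) y^(j1+1))^p v^(p-1-i0) (- (x^k + y^k v))^(p-1-j0) dv,
   a polynomial in v over L^p of degree 2(p-1) - i0 - j0. The Cartier operator
   reads off the coefficient of v^(p-1): it is zero if i0 + j0 >= p, and
   otherwise it is, up to a nonzero constant, the p-th power of a monomial in
   x, y that determines (i, j). So the kernel is spanned by the x^i y^j w0 with
   i1 + j1 <= s - 2 and i0 + j0 >= p, of which there are C(s, 2) C(p, 2). *)

Require Import Defs.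
From HB Require Import structures.
From mathcomp Require Import all_boot all_order all_algebra.
From Stdlib Require Import IndefiniteDescription.
From mathcomp Require Import ring lra zify.
From mathcomp Require Import mpoly.

Set Implicit Arguments.
Unset Strict Implicit.
Unset Printing Implicit Defensive.

Import GRing.Theory.
Local Open Scope ring_scope.

(** The shape of the holomorphic differentials is derived from local rings alone, without divisors
    or Riemann-Roch. Regularity at a point turns the coefficient g of w0 into a local section of O(k
    - 1), where k - 1 = deg F - 3. The affine points then force g to be a polynomial, and the two
    points at infinity lower its degree one step at a time down to k - 1.

    The variable v is chosen because p divides k: x^k and y^k are p-th powers, which makes 1 / y
    affine in v over L^p.

    The degree in v may exceed p - 1, so the polynomial need not be the reduced expansion. Since v^p
    lies in L^p, exponents from p to 2(p-1) fold back onto 0, ..., p - 2 and never reach p - 1, so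
    the coefficient of v^(p-1) is still the right one. Independence of the powers of v over L^p is
    replaced by formal differentiation of relations in v.

    To separate the surviving monomials, p-th roots of the scalars make their sum a single p-th
    power; its base is a combination of monomials of degree below deg F, hence independent on the
    curve. *)

Lemma ord3P (i : 'I_3) : [\/ i = 0, i = 1 | i = 2].
Proof.
by case: i => [[|[|[|//]]] ?]; [apply: Or31 | apply: Or32 | apply: Or33];
  apply: val_inj.
Qed.

Lemma big_ord3 T (idx : T) (op : Monoid.law idx) (E : 'I_3 -> T) :
  \big[op/idx]_i E i = op (op (E 0) (E 1)) (E 2).
Proof.
rewrite !big_ord_recl big_ord0 Monoid.mulm1 Monoid.mulmA.
by congr (op (op (E _) (E _)) (E _)); apply: val_inj.
Qed.

Lemma mdeg3 (m : 'X_{1..3}) : mdeg m = (m 0%R + m 1%R + m 2%R)%N.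
Proof. by rewrite mdegE big_ord3. Qed.

(** * Evaluation at the generic point and derivations *)

Section Heval.

Variables (K L : fieldType) (iota : {rmorphism K -> L}) (x y : L).

HB.instance Definition _ := GRing.RMorphism.copy (heval iota x y)
  (mmap iota (fun i : 'I_3 => [:: x; y; 1]`_i)).

Local Notation hv := (heval iota x y).

Lemma hevalU i : hv 'X_i = [:: x; y; 1]`_i.
Proof. by rewrite /heval mmapX mmap1U. Qed.

Lemma hevalC c : hv c%:MP = iota c.
Proof. by rewrite /heval mmapC. Qed.

Lemma hevalZ c A : hv (c *: A) = iota c * hv A.
Proof. by rewrite /heval mmapZ. Qed.

Lemma heval_monomial m : hv 'X_[m] = x ^+ m 0 * y ^+ m 1.
Proof. by rewrite /heval mmapX /mmap1 big_ord3 /= expr1n mulr1. Qed.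

Lemma hevalE A : hv A = \sum_(m <- msupp A) iota A@_m * (x ^+ m 0 * y ^+ m 1).
Proof.
rewrite {1}[A]mpolyE rmorph_sum /=; apply: eq_bigr => m _.
by rewrite hevalZ heval_monomial.
Qed.

End Heval.

Section Derivation.

Variables (K L : fieldType) (iota : {rmorphism K -> L}) (x y : L).
Variables (M : lmodType L) (D : L -> M).
Hypothesis hD : derivation iota D.

Local Notation hv := (heval iota x y).

Lemma derivationD f g : D (f + g) = D f + D g. Proof. by case: hD. Qed.

Lemma derivationM f g : D (f * g) = f *: D g + g *: D f.
Proof. by case: hD. Qed.

Lemma derivationC c : D (iota c) = 0. Proof. by case: hD. Qed.

Lemma derivation0 : D 0 = 0.
Proof. by rewrite -(rmorph0 iota) derivationC. Qed.

Lemma derivation1 : D 1 = 0.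
Proof. by rewrite -(rmorph1 iota) derivationC. Qed.

Lemma derivation_sum I (r : seq I) (P : pred I) (E : I -> L) :
  D (\sum_(i <- r | P i) E i) = \sum_(i <- r | P i) D (E i).
Proof. exact: (big_morph D derivationD derivation0). Qed.

Lemma derivationX f k : D (f ^+ k) = (k%:R * f ^+ k.-1) *: D f.
Proof.
elim: k => [|k IHk]; first by rewrite expr0 derivation1 mul0r scale0r.
rewrite exprS derivationM IHk scalerA -scalerDl; congr (_ *: _).
case: k {IHk} => [|k]; first by rewrite !expr0 mul0r mulr0 add0r mulr1.
by rewrite /= mulrCA -exprS -[in RHS]natr1 mulrDl mul1r.
Qed.

Lemma derivation_pchar p f : p \in [pchar L] -> D (f ^+ p) = 0.
Proof. by move=> hp; rewrite derivationX (pcharf0 hp) mul0r scale0r. Qed.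

Lemma derivationV f : f != 0 -> D f^-1 = - (f ^- 2) *: D f.
Proof.
move=> f0; have := derivation1; rewrite -[in D 1](mulfV f0) derivationM.
move/eqP; rewrite addr_eq0 => /eqP /(congr1 (fun v => f^-1 *: v)).
by rewrite scalerA mulVf // scale1r scalerN scalerA scaleNr -invfM -expr2.
Qed.

Lemma derivation_div f g : g != 0 ->
  D (f / g) = g ^- 2 *: (g *: D f - f *: D g).
Proof.
move=> g0; rewrite derivationM derivationV // scalerBr !scalerA addrC.
congr (_ + _); first by congr (_ *: _); field.
by rewrite -scaleNr; congr (_ *: _); field.
Qed.

(** The chain rule; Z contributes no term because it is specialised to the constant 1. *)
Lemma derivation_heval A :
  D (hv A) = hv A^`M(0) *: D x + hv A^`M(1) *: D y.
Proof.
elim/mpolyind: A => [|c m A _ _ IHA].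
  by rewrite !mderiv0 rmorph0 !scale0r derivation0 addr0.
rewrite !mderivD !mderivZ !mderivX !rmorphD /= derivationD IHA !scalerDl.
rewrite addrACA; congr (_ + _); rewrite !hevalZ !heval_monomial.
rewrite !derivationM derivationC scaler0 addr0 !derivationX !rmorph_nat.
rewrite !mnmBE !mnm1E /= !subn0 !subn1 addrC scalerDr !scalerA.
by congr (_ *: _ + _ *: _); ring.
Qed.

End Derivation.

Section Euler.

Variables (K : fieldType) (k : nat).

Lemma dhomog_mderiv i e (A : {mpoly K[k]}) :
  A \is e.-homog -> A^`M(i) \is e.-1.-homog.
Proof.
move=> hA; apply/dhomogP => m; rewrite mcoeff_msupp mcoeff_deriv => hm.
have /(dhomog_mf hA) /= : (m + U_(i))%MM \in msupp A.
  by rewrite mcoeff_msupp; apply: contraNneq hm => ->; rewrite mul0rn.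
by rewrite mdegD mdeg1 addn1 => <-.
Qed.

Lemma dhomogU i : ('X_i : {mpoly K[k]}) \is 1.-homog.
Proof. by rewrite dhomogX /= mdeg1. Qed.

Lemma dhomogUn i e : ('X_i ^+ e : {mpoly K[k]}) \is e.-homog.
Proof. by rewrite -[X in X.-homog]mul1n dhomogMn ?dhomogU. Qed.

Lemma euler_identity e (A : {mpoly K[k]}) : A \is e.-homog ->
  \sum_(i < k) 'X_i * A^`M(i) = e%:R *: A.
Proof.
move=> hA; rewrite [A in RHS]mpolyE scaler_sumr.
under eq_bigr do rewrite {1}[A]mpolyE raddf_sum mulr_sumr.
rewrite exchange_big /= !big_seq; apply: eq_bigr => m hm.
rewrite -(dhomog_mf hA hm) /= mdegE natr_sum scaler_suml.
apply: eq_bigr => i _; rewrite mderivZ mderivX -!scalerAr.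
case: (posnP (m i)) => [->|mi]; first by rewrite !scale0r scaler0.
rewrite scalerA mulrC -scalerA -mpolyXD addmC submK //; apply/mnm_lepP => j.
by rewrite mnm1E; case: eqP => [<-|].
Qed.

End Euler.

(** * The function field of a Hurwitz curve *)

Section Hurwitz.

Variables (K : fieldType) (k : nat).
Hypothesis kK : k%:R = 0 :> K.

Local Notation F := (hurwitz K k.+1).

Lemma mderiv_exp n (A : {mpoly K[n]}) e i :
  (A ^+ e)^`M(i) = e%:R *: (A ^+ e.-1 * A^`M(i)).
Proof.
elim: e => [|e IHe]; first by rewrite expr0 -mpolyC1 mderivC scale0r.
rewrite exprS mderivM IHe; case: e {IHe} => [|e].
  by rewrite !expr0 scale0r mulr0 addr0 mulr1 mul1r scale1r.
by rewrite /= exprS -[e.+2%:R]natr1 scalerDl scale1r -!mul_mpolyC; ring.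
Qed.

Lemma mderivU n (i j : 'I_n) : ('X_i : {mpoly K[n]})^`M(j) = (i == j)%:R.
Proof.
rewrite mderivX mnm1E; case: eqP => [->|_]; last by rewrite scale0r.
rewrite scale1r (_ : _ - _ = 0)%MM ?mpolyX0 //.
by apply/mnmP => l; rewrite mnmBE mnm0E subnn.
Qed.

Lemma hurwitz_homog : F \is k.+2.-homog.
Proof.
by rewrite -[k.+2]addn1 !rpredD // dhomogM ?dhomogUn ?dhomogU.
Qed.

Lemma meval_hurwitz P : F.@[P] =
  P 0 ^+ k.+1 * P 1 + P 1 ^+ k.+1 * P 2 + P 2 ^+ k.+1 * P 0.
Proof. by rewrite !mevalD !mevalM !rmorphXn /= !mevalXU. Qed.

Lemma hurwitz_neq0 : F != 0.
Proof.
apply/eqP => /(congr1 (meval (fun i : 'I_3 => [:: 1; 1; 0]`_i)))/eqP.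
rewrite meval0 meval_hurwitz /=.
by rewrite !expr1n expr0n !mulr0 !mul0r !addr0 mulr1 oner_eq0.
Qed.

Lemma hurwitz_dX : F^`M(0) = 'X_0 ^+ k * 'X_1 + 'X_2 ^+ k.+1.
Proof.
rewrite /hurwitz !mderivD !mderivM !mderiv_exp !mderivU /=.
by rewrite -!natr1 kK !add0r !scale1r; ring.
Qed.

Lemma hurwitz_dY : F^`M(1) = 'X_0 ^+ k.+1 + 'X_1 ^+ k * 'X_2.
Proof.
rewrite /hurwitz !mderivD !mderivM !mderiv_exp !mderivU /=.
by rewrite -!natr1 kK !add0r !scale1r; ring.
Qed.

Lemma hurwitz_dZ : F^`M(2) = 'X_1 ^+ k.+1 + 'X_2 ^+ k * 'X_0.
Proof.
rewrite /hurwitz !mderivD !mderivM !mderiv_exp !mderivU /=.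
by rewrite -!natr1 kK !add0r !scale1r; ring.
Qed.

Variables (L : fieldType) (iota : {rmorphism K -> L}) (x y : L).
Hypothesis hL : function_field iota F x y.

Local Notation hv := (heval iota x y).
Local Notation fX := (x ^+ k * y + 1).
Local Notation fY := (x ^+ k.+1 + y ^+ k).
Local Notation fZ := (y ^+ k.+1 + x).

Lemma heval_dX : hv F^`M(0) = fX.
Proof.
by rewrite hurwitz_dX rmorphD rmorphM !rmorphXn /= !hevalU /= expr1n.
Qed.

Lemma heval_dY : hv F^`M(1) = fY.
Proof.
by rewrite hurwitz_dY rmorphD rmorphM !rmorphXn /= !hevalU /= mulr1.
Qed.

Lemma heval_dZ : hv F^`M(2) = fZ.
Proof.
by rewrite hurwitz_dZ rmorphD rmorphM !rmorphXn /= !hevalU /= expr1n mul1r.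
Qed.

Lemma heval_eq0 e A : A \is e.-homog -> hv A = 0 -> exists Q, A = Q * F.
Proof. by case: hL => h _ hA /(h e A hA). Qed.

Lemma heval_hurwitz : hv F = 0.
Proof.
by case: hL => h _; apply/(h _ _ hurwitz_homog); exists 1; rewrite mul1r.
Qed.

Lemma curve_equation : x ^+ k.+1 * y + y ^+ k.+1 + x = 0.
Proof.
have := heval_hurwitz; rewrite !rmorphD !rmorphM !rmorphXn /=.
by rewrite !hevalU /= expr1n mul1r mulr1.
Qed.

Lemma euler_curve : x * fX + y * fY + fZ = 0.
Proof. by rewrite -[0](mulr0 2) -curve_equation !exprS; ring. Qed.

Lemma msize_dhomog n e (A : {mpoly K[n]}) :
  A \is e.-homog -> A != 0 -> msize A = e.+1.
Proof.
by move=> hA A0; rewrite -mlead_deg // (dhomog_mf hA) ?mlead_supp.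
Qed.

(** A nonzero multiple of [F] has degree at least k + 2. Both the nonvanishing of x and y and the
    independence of monomials rest on this. *)
Lemma heval_low e A : (e <= k.+1)%N -> A \is e.-homog -> hv A = 0 -> A = 0.
Proof.
move=> le_ek hA /(heval_eq0 hA)[Q AQ]; apply/eqP/negPn/negP => A0.
have Q0 : Q != 0 by apply: contraNneq A0 => Q0; rewrite AQ Q0 mul0r.
have := msize_dhomog hA A0.
rewrite AQ msizeM ?hurwitz_neq0 // (msize_dhomog hurwitz_homog hurwitz_neq0).
have : (0 < msize Q)%N by rewrite lt0n msize_poly_eq0.
case: (msize Q) => // q _; rewrite addSn /= => /eqP.
rewrite addnS eqSS => /eqP eqe.
by move: le_ek; rewrite -eqe addnS ltnNge leq_addl.
Qed.

Lemma hevalU_neq0 i : hv 'X_i != 0.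
Proof.
apply/eqP => /(heval_low (isT : 1 <= k.+1)%N (dhomogU _ _)) Xi0.
by have := msizeX K U_(i)%MM; rewrite Xi0 msize0 mdeg1.
Qed.

Lemma x_neq0 : x != 0.
Proof. by have := hevalU_neq0 0; rewrite hevalU. Qed.

Lemma y_neq0 : y != 0.
Proof. by have := hevalU_neq0 1; rewrite hevalU. Qed.

(** Since p divides k, f_y is x^(k+1) + y^k, and y f_y is the equation of the curve without its term
    x. This is what turns dx / f_y into x y dv. *)
Lemma yfY : y * fY = - x.
Proof.
by apply/eqP; rewrite -addr_eq0 -curve_equation !exprS; apply/eqP; ring.
Qed.

Lemma fY_neq0 : fY != 0.
Proof.
by apply: contraTneq x_neq0 => f0; rewrite negbK -oppr_eq0 -yfY f0 mulr0.
Qed.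

Lemma hurwitz_derivation (M : lmodType L) (D : L -> M) : derivation iota D ->
  fY *: D y = - (fX *: D x).
Proof.
move=> hD; apply/eqP; rewrite addrC -addr_eq0 addrC -heval_dX -heval_dY addrC.
by rewrite -derivation_heval // heval_hurwitz (derivation0 hD).
Qed.

End Hurwitz.

(** * The tangent derivation of the curve *)

Section HurwitzDerivation.

Variables (K : fieldType) (k : nat).
Hypothesis kK : k%:R = 0 :> K.

Local Notation F := (hurwitz K k.+1).

Variables (L : fieldType) (iota : {rmorphism K -> L}) (x y : L).
Hypothesis hL : function_field iota F x y.

Local Notation hv := (heval iota x y).
Local Notation fX := (x ^+ k * y + 1).
Local Notation fY := (x ^+ k.+1 + y ^+ k).

(** The vector field F_Y d/dX - F_X d/dY, tangent to the curve: it annihilates [F], so it descends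
    to values at the generic point. *)
Definition hform_deriv (A : {mpoly K[3]}) :=
  hv A^`M(0) * fY - hv A^`M(1) * fX.

Lemma hform_derivB A B : hform_deriv (A - B) = hform_deriv A - hform_deriv B.
Proof. by rewrite /hform_deriv !mderivB !rmorphB /=; ring. Qed.

Lemma hform_derivD A B : hform_deriv (A + B) = hform_deriv A + hform_deriv B.
Proof. by rewrite /hform_deriv !mderivD !rmorphD /=; ring. Qed.

Lemma hform_derivM A B :
  hform_deriv (A * B) = hv A * hform_deriv B + hv B * hform_deriv A.
Proof. by rewrite /hform_deriv !mderivM !rmorphD !rmorphM /=; ring. Qed.

Lemma hform_deriv_eq e A B : A \is e.-homog -> B \is e.-homog ->
  hv A = hv B -> hform_deriv A = hform_deriv B.
Proof.
move=> hA hB /eqP; rewrite -subr_eq0 -rmorphB => /eqP /=.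
case/(heval_eq0 hL (rpredB hA hB)) => Q eqQ.
apply/eqP; rewrite -subr_eq0 -hform_derivB eqQ hform_derivM.
rewrite (heval_hurwitz hL) mul0r addr0 /hform_deriv.
by rewrite (heval_dX kK) (heval_dY kK); apply/eqP; ring.
Qed.

Definition hfrac_deriv A B :=
  (hv B * hform_deriv A - hv A * hform_deriv B) / hv B ^+ 2.

Lemma hfrac_deriv_eq e A B e' A' B' : A \is e.-homog -> B \is e.-homog ->
    A' \is e'.-homog -> B' \is e'.-homog -> hv B != 0 -> hv B' != 0 ->
  hv A / hv B = hv A' / hv B' -> hfrac_deriv A B = hfrac_deriv A' B'.
Proof.
move=> hA hB hA' hB' b0 b'0 /eqP; rewrite eqr_div // -!rmorphM /= => /eqP eqAB.
have hAB' := dhomogM hA hB'; have hA'B := dhomogM hA' hB.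
rewrite addnC in hA'B; have := hform_deriv_eq hAB' hA'B eqAB.
move: eqAB; rewrite !hform_derivM !rmorphM /= /hfrac_deriv => eqAB eqD.
apply/eqP; rewrite eqr_div ?expf_neq0 // -subr_eq0; apply/eqP.
transitivity (hv B * hv B' * (hv A * hform_deriv B' + hv B' * hform_deriv A
  - (hv A' * hform_deriv B + hv B * hform_deriv A'))
  + (hv A' * hv B - hv A * hv B') * 
    (hv B' * hform_deriv B + hv B * hform_deriv B')); first by ring.
by rewrite eqD eqAB !subrr mulr0 mul0r addr0.
Qed.

(** A derivation that does not kill x is the only way to see that d x is nonzero in the universal
    module. *)
Lemma exists_hurwitz_derivation :
  exists D : L -> L^o, [/\ derivation iota D, D x = fY & D y = - fX].
Proof.
pose R f v := exists e A B, [/\ A \is e.-homog, B \is e.-homog, hv B != 0,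
  f = hv A / hv B & v = hfrac_deriv A B].
have exR f : exists v, R f v.
  case: hL => _ /(_ f)[e [A [B [hA hB B0 ->]]]].
  by exists (hfrac_deriv A B), e, A, B.
(* [D] is built from an arbitrary representation of each element as a quotient of forms; [DE] shows
   that every other representation gives the same value. *)
have [D hD] := functional_choice R exR.
have DE e A B : A \is e.-homog -> B \is e.-homog -> hv B != 0 ->
    D (hv A / hv B) = hfrac_deriv A B.
  move=> hA hB B0; have [e' [A' [B' [hA' hB' B'0 eqf ->]]]] := hD (hv A / hv B).
  by rewrite -(hfrac_deriv_eq hA hB hA' hB' B0 B'0 eqf).
exists D; split; first split.
- move=> f g.
  have [e [A [B [hA hB B0 -> ->]]]] := hD f.
  have [e' [A' [B' [hA' hB' B'0 -> ->]]]] := hD g.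
  rewrite addf_div // -!rmorphM -rmorphD /=.
  rewrite (@DE (e + e')%N) ?dhomogM ?rpredD ?rmorphM ?mulf_neq0 //=.
  - rewrite /hfrac_deriv hform_derivD !hform_derivM !rmorphD !rmorphM /=.
    by field; apply/andP; split; [exact: B'0 | exact: B0].
  - by rewrite dhomogM.
  - by rewrite addnC dhomogM.
- move=> f g.
  have [e [A [B [hA hB B0 -> ->]]]] := hD f.
  have [e' [A' [B' [hA' hB' B'0 -> ->]]]] := hD g.
  rewrite mulf_div // -!rmorphM /=.
  rewrite (@DE (e + e')%N) ?dhomogM ?rmorphM ?mulf_neq0 //=.
  rewrite /hfrac_deriv !hform_derivM !rmorphM /= /GRing.scale /=.
  by field; apply/andP; split; first [exact: B0 | exact: B'0].
- move=> c; have := @DE 0 c%:MP 1; rewrite hevalC rmorph1 divr1.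
  move=> ->; rewrite ?oner_neq0 ?dhomog1 //.
    by rewrite /hfrac_deriv /hform_deriv -mpolyC1 !mderivC !rmorph0; ring.
  by rewrite -[c%:MP]mulr1 mul_mpolyC dhomogZ ?dhomog1.
- have := @DE 1 'X_0 'X_2 (dhomogU _ _) (dhomogU _ _).
  rewrite !hevalU /= divr1 oner_neq0 => -> //.
  rewrite /hfrac_deriv /hform_deriv !mderivU !hevalU /= !rmorph_nat /=.
  by rewrite expr1n divr1; ring.
- have := @DE 1 'X_1 'X_2 (dhomogU _ _) (dhomogU _ _).
  rewrite !hevalU /= divr1 oner_neq0 => -> //.
  rewrite /hfrac_deriv /hform_deriv !mderivU !hevalU /= !rmorph_nat /=.
  by rewrite expr1n divr1; ring.
Qed.

End HurwitzDerivation.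

(** * Differentials regular at a point *)

Section HolomorphicLocal.

Variables (K : fieldType) (k : nat).
Hypotheses (kK : k%:R = 0 :> K) (k_gt0 : (0 < k)%N).

Local Notation F := (hurwitz K k.+1).

Variables (L : fieldType) (iota : {rmorphism K -> L}) (x y : L).
Hypothesis hL : function_field iota F x y.

Local Notation hv := (heval iota x y).
Local Notation fX := (x ^+ k * y + 1).
Local Notation fY := (x ^+ k.+1 + y ^+ k).
Local Notation fZ := (y ^+ k.+1 + x).

(** The linear map induced by [D] sends dx / f_y to 1, so this differential is nonzero.
    Differentiating the equation of the curve makes d x and d y multiples of it, with the same
    coefficients as for [D]. *)
Lemma kaehler_generator (Omega : lmodType L) (d : L -> Omega) :
  kaehler iota d ->
  exists D : L -> L^o, [/\ derivation iota D, D x = fY, D y = - fX,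
    fY^-1 *: d x != 0 & forall f, d f = D f *: (fY^-1 *: d x)].
Proof.
case=> hd univ; have [D [hD Dx Dy]] := exists_hurwitz_derivation kK hL.
have fY0 := fY_neq0 hL.
have dxE : d x = fY *: (fY^-1 *: d x) by rewrite scalerA mulfV ?scale1r.
have dyE : d y = - fX *: (fY^-1 *: d x).
  rewrite scalerA mulrC -scalerA scaleNr -(hurwitz_derivation kK hL hd).
  by rewrite scalerA mulVf ?scale1r.
exists D; split=> //.
  have [phi [phiE _]] := univ _ D hD; apply/eqP => /(congr1 phi)/eqP.
  by rewrite linear0 linearZ /= phiE Dx /GRing.scale /= mulVf ?oner_eq0.
move: (_ *: d x) dxE dyE => w dxE dyE.
have dF A : d (hv A) = D (hv A) *: w.
  rewrite (derivation_heval _ _ hd) (derivation_heval _ _ hD) Dx Dy.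
  by rewrite dxE dyE !scalerA -scalerDl.
move=> f; case: hL => _ /(_ f)[e [A [B [hA hB B0 ->]]]].
rewrite (derivation_div hd) // (derivation_div hD) // !dF.
by rewrite !scalerA -scalerBl scalerA.
Qed.

(** The stalk at P of the sheaf O(j), a section being read in the chart Z = 1. *)
Definition local_form (P : 'I_3 -> K) (j : nat) (g : L) :=
  exists e A B, [/\ A \is (e + j).-homog, B \is e.-homog, B.@[P] != 0
    & hv B * g = hv A].

Lemma local_form0 P j : local_form P j 0.
Proof.
exists 0, 0, 1; split; rewrite ?rpred0 ?dhomog1 ?meval1 ?oner_neq0 //.
by rewrite mulr0 rmorph0.
Qed.

Lemma local_formD P j f g :
  local_form P j f -> local_form P j g -> local_form P j (f + g).
Proof.
case=> [e [A [B [hA hB B0 eqA]]]] [e' [A' [B' [hA' hB' B'0 eqA']]]].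
exists (e + e')%N, (B' * A + B * A'), (B * B'); split.
- apply: rpredD; last by rewrite -addnA dhomogM.
  by rewrite addnAC addnC dhomogM.
- by rewrite dhomogM.
- by rewrite mevalM mulf_neq0.
- by rewrite rmorphD !rmorphM /= -eqA -eqA'; ring.
Qed.

Lemma local_formM P i j f g :
  local_form P i f -> local_form P j g -> local_form P (i + j) (f * g).
Proof.
case=> [e [A [B [hA hB B0 eqA]]]] [e' [A' [B' [hA' hB' B'0 eqA']]]].
exists (e + e')%N, (A * A'), (B * B'); split.
- by rewrite addnACA dhomogM.
- by rewrite dhomogM.
- by rewrite mevalM mulf_neq0.
- by rewrite !rmorphM /= -eqA -eqA'; ring.
Qed.

Lemma local_form_sum P j I (r : seq I) (E : I -> L) :
  (forall i, local_form P j (E i)) -> local_form P j (\sum_(i <- r) E i).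
Proof.
move=> hE; elim/big_rec: _ => [|i f _]; first exact: local_form0.
exact: local_formD.
Qed.

Lemma heval_neq0_on_curve P e B : on_curve F P -> B \is e.-homog ->
  B.@[P] != 0 -> hv B != 0.
Proof.
move=> [_ FP] hB; apply: contraNneq => /(heval_eq0 hL hB)[Q ->].
by rewrite mevalM FP mulr0.
Qed.

Lemma regular_local_form P f : on_curve F P ->
  regular_at iota x y P f -> local_form P 0 f.
Proof.
move=> hP [e [A [B [hA hB B0 ->]]]]; exists e, A, B; split=> //.
  by rewrite addn0.
by rewrite mulrC mulfVK // (heval_neq0_on_curve hP hB).
Qed.

(* With U_C := B A_C - A B_C, Euler's identity gives x U_X + y U_Y + U_Z = 0 and
   x F_X + y F_Y + F_Z = 0 on the curve, so multiplying U_X F_Y - U_Y F_X by x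
   or y turns it into another 2-minor times Z, which lowers the degree by one
   at the points at infinity. *)
Lemma jacobian_divisible e A B i : A \is e.+1.-homog -> B \is e.+1.-homog ->
  exists2 G, G \is (e.*2.+2 + k).-homog &
    hv 'X_i * (hv B * (hv A^`M(0) * fY - hv A^`M(1) * fX)
               - hv A * (hv B^`M(0) * fY - hv B^`M(1) * fX)) = hv G.
Proof.
move=> hA hB; pose U j := B * A^`M(j) - A * B^`M(j).
have hU j : U j \is (e.*2.+1).-homog.
  have -> : (e.*2.+1 = e.+1 + e)%N by rewrite addSn addnn.
  by rewrite rpredB ?dhomogM //; apply: (dhomog_mderiv j (e := e.+1)).
have hF j : F^`M(j) \is k.+1.-homog.
  exact: (dhomog_mderiv j (hurwitz_homog K k)).
have eulerU : x * hv (U 0) + y * hv (U 1) + hv (U 2) = 0.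
  have euler2 C : C \is e.+1.-homog -> x * hv C^`M(0) + y * hv C^`M(1)
    + hv C^`M(2) = iota e.+1%:R * hv C.
    move=> /euler_identity/(congr1 hv); rewrite hevalZ => <-.
    by rewrite big_ord3 !rmorphD !rmorphM /= !hevalU /= mul1r.
  rewrite !rmorphB !rmorphM /=.
  transitivity (hv B * (x * hv A^`M(0) + y * hv A^`M(1) + hv A^`M(2)) -
    hv A * (x * hv B^`M(0) + y * hv B^`M(1) + hv B^`M(2))); first by ring.
  by rewrite !euler2 //; ring.
have eqU2 : hv (U 2) = - (x * hv (U 0) + y * hv (U 1)).
  by apply/eqP; rewrite -addr_eq0 addrC eulerU.
have fZE : fZ = - (x * fX + y * fY).
  by apply/eqP; rewrite -addr_eq0 addrC (euler_curve hL).
have hG a b c j : U a * F^`M(b) - U c * F^`M(j) \is (e.*2.+2 + k).-homog.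
  by rewrite addSnnS rpredB // dhomogM.
set J := hv B * _ - _.
have JE : J = hv (U 0) * fY - hv (U 1) * fX.
  by rewrite /J !rmorphB !rmorphM /=; ring.
rewrite JE hevalU; clear J JE; clearbody U; have [->|->|->] /= := ord3P i.
- exists (U 1 * F^`M(2) - U 2 * F^`M(1)); first exact: hG.
  rewrite rmorphB !rmorphM /=. rewrite (heval_dZ kK) (heval_dY kK) eqU2 fZE.
  by ring.
- exists (U 2 * F^`M(0) - U 0 * F^`M(2)); first exact: hG.
  rewrite rmorphB !rmorphM /= (heval_dZ kK) (heval_dX kK) eqU2 fZE.
  by ring.
- exists (U 0 * F^`M(1) - U 1 * F^`M(0)); first exact: hG.
  by rewrite rmorphB !rmorphM /= (heval_dY kK) (heval_dX kK); ring.
Qed.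

(** Half of adjunction: in terms of the generator dx / f_y, a differential regular at P is a local
    section of O(deg F - 3). *)
Lemma local_form_derivation P (D : L -> L^o) t : derivation iota D ->
    D x = fY -> D y = - fX -> on_curve F P -> regular_at iota x y P t ->
  local_form P k.-1 (D t).
Proof.
move=> hD Dx Dy hP [e0 [A0 [B0 [hA0 hB0 B0P ->]]]].
case: (hP) => -[i Pi] _.
have [e [A [B [hA hB BP ->]]]] : exists e A B, [/\ A \is e.+1.-homog,
    B \is e.+1.-homog, B.@[P] != 0 & hv A0 / hv B0 = hv A / hv B].
  (* Multiplying by a coordinate that is nonzero at [P] makes the degree positive, so that the
     partial derivatives have degree exactly one less. *)
  exists e0, (A0 * 'X_i), (B0 * 'X_i).
  rewrite -[e0.+1]addn1 !dhomogM ?dhomogU // mevalM mevalXU mulf_neq0 //.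
  rewrite !rmorphM /=.
  split=> //; rewrite -mulf_div mulfV ?mulr1 //.
  by rewrite (heval_neq0_on_curve hP (dhomogU _ _)) ?mevalXU.
have [G hG eqG] := jacobian_divisible i hA hB.
have b0 := heval_neq0_on_curve hP hB BP.
exists (e.*2.+3), G, ('X_i * B ^+ 2); split.
- by case: k k_gt0 hG => // k' _; rewrite addnS.
- have -> : (e.*2.+3 = 1 + e.+1 * 2)%N by rewrite muln2.
  by rewrite dhomogM ?dhomogU ?dhomogMn.
- by rewrite mevalM mevalXU rmorphXn /= mulf_neq0 ?expf_neq0.
- rewrite -eqG (derivation_div hD) // !(derivation_heval _ _ hD) Dx Dy.
  by rewrite rmorphM rmorphXn /= /GRing.scale /=; field.
Qed.

Lemma holomorphic_local_form (Omega : lmodType L) (d : L -> Omega) omega :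
  kaehler iota d -> holomorphic iota d F x y omega ->
  exists2 g, omega = g *: (fY^-1 *: d x) &
    forall P, on_curve F P -> local_form P k.-1 g.
Proof.
move=> hd; have [D [hD Dx Dy w0 dE]] := kaehler_generator hd.
set w := _ *: d x in w0 dE *.
have loc P : on_curve F P -> regular_diff_at iota d x y P omega ->
    exists2 g, omega = g *: w & local_form P k.-1 g.
  move=> hP [m [g [t [hg ht ->]]]]; exists (\sum_(i < m) g i * D (t i)).
    by rewrite scaler_suml; apply: eq_bigr => i _; rewrite dE scalerA.
  apply: local_form_sum => i; rewrite -[k.-1]add0n; apply: local_formM.
    exact: regular_local_form.
  exact: local_form_derivation.
(* One coefficient must serve all points. It is taken at (0 : 0 : 1), which lies on the curve; as
   [w] is nonzero, the coefficients found at other points coincide with it. *)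
move=> hol; pose P0 (i : 'I_3) : K := (i == 2)%:R.
have hP0 : on_curve F P0.
  split; first by exists 2; rewrite oner_neq0.
  rewrite meval_hurwitz /P0 /=.
  by rewrite !expr0n /= !mulr0 !mul0r !addr0.
have [g eqg _] := loc _ hP0 (hol _ hP0); exists g => // P hP.
have [g' eqg' hg'] := loc _ hP (hol _ hP).
suff -> : g = g' by [].
have : (g - g') *: w == 0 by rewrite scalerBl -eqg -eqg' subrr.
by rewrite scaler_eq0 (negPf w0) orbF subr_eq0 => /eqP.
Qed.

End HolomorphicLocal.

Section HolomorphicForms.

Variables (K : fieldType) (k : nat).
Hypotheses (kK : k%:R = 0 :> K) (k_gt0 : (0 < k)%N).

Local Notation F := (hurwitz K k.+1).

Variables (L : fieldType) (iota : {rmorphism K -> L}) (x y : L).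
Hypothesis hL : function_field iota F x y.

Local Notation hv := (heval iota x y).
Local Notation fY := (x ^+ k.+1 + y ^+ k).
Local Notation fZ := (y ^+ k.+1 + x).

(** The curve is smooth. Where a partial derivative B of [F] does not vanish, dx / f_y is, up to
    sign, X_j^2 / B times d(X_i / X_j) for suitable i and j; the form [A] of degree k - 1 balances
    the degree k + 1 of B. *)
Lemma holomorphic_form (Omega : lmodType L) (d : L -> Omega) A :
  kaehler iota d -> A \is k.-1.-homog ->
  holomorphic iota d F x y (hv A *: (fY^-1 *: d x)).
Proof.
move=> hd hA P hP; have [D [hD Dx Dy _ dE]] := kaehler_generator kK hL hd.
have [x0 y0] := (x_neq0 hL, y_neq0 hL).
have hF j : F^`M(j) \is k.+1.-homog.
  exact: (dhomog_mderiv j (hurwitz_homog K k)).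
have loc B i j c : B.@[P] != 0 -> P j != 0 -> B \is k.+1.-homog ->
    iota c * (hv 'X_j ^+ 2 / hv B) * D (hv 'X_i / hv 'X_j) = 1 ->
    regular_diff_at iota d x y P (hv A *: (fY^-1 *: d x)).
  move=> BP Pj hB eq1.
  exists 1, (fun=> hv (c *: A * 'X_j ^+ 2) / hv B), (fun=> hv 'X_i / hv 'X_j).
  split=> [_|_|].
  - exists k.+1, (c *: A * 'X_j ^+ 2), B; split=> //.
    have -> : k.+1 = (k.-1 + 2)%N by rewrite addn2 prednK.
    by rewrite dhomogM ?dhomogZ ?dhomogUn.
  - by exists 1, 'X_i, 'X_j; split; rewrite ?dhomogU ?mevalXU.
  rewrite big_ord1 [d (_ / _)]dE [RHS]scalerA; congr (_ *: _).
  rewrite rmorphM rmorphXn /= hevalZ -[LHS]mulr1 -eq1.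
  by move: (D _ : L) => v; ring.
case: (hP) => -[i0 Pi0] FP.
have FPE : P 0 ^+ k.+1 * P 1 + P 1 ^+ k.+1 * P 2 + P 2 ^+ k.+1 * P 0 = 0.
  by rewrite -meval_hurwitz.
have FXP : F^`M(0).@[P] = P 0 ^+ k * P 1 + P 2 ^+ k.+1.
  by rewrite (hurwitz_dX kK) rmorphD rmorphM !rmorphXn /= !mevalXU.
have FYP : F^`M(1).@[P] = P 0 ^+ k.+1 + P 1 ^+ k * P 2.
  by rewrite (hurwitz_dY kK) rmorphD rmorphM !rmorphXn /= !mevalXU.
have FZP : F^`M(2).@[P] = P 1 ^+ k.+1 + P 2 ^+ k * P 0.
  by rewrite (hurwitz_dZ kK) rmorphD rmorphM !rmorphXn /= !mevalXU.
have curveP Q : Q \is k.+1.-homog -> Q.@[P] != 0 -> hv Q != 0.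
  exact: (heval_neq0_on_curve hL hP).
have X2 : hv 'X_2 = 1 by rewrite hevalU.
have [P2|P2] := eqVneq (P 2) 0; last first.
  have [FYP0|FYP0] := eqVneq F^`M(1).@[P] 0; last first.
    apply: (loc F^`M(1) 0 2 1) => //.
    rewrite X2 !hevalU /= !divr1 Dx rmorph1 (heval_dY kK).
    by field; exact: fY_neq0 hL.
  (* F = Y F_Y + Z^(k+1) X, so F_Y = 0 with Z nonzero forces X = 0, and then F_X = Z^(k+1) is
     nonzero. *)
  have P0 : P 0 = 0.
    have /eqP : P 2 ^+ k.+1 * P 0 = 0.
      rewrite -[RHS]FPE -[LHS]add0r -{1}[0](mulr0 (P 1)) -FYP0 FYP !exprS.
      by ring.
    by rewrite mulf_eq0 expf_eq0 (negPf P2) /= => /eqP.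
  have FXP0 : F^`M(0).@[P] != 0.
    by rewrite FXP P0 expr0n gtn_eqF // mul0r add0r expf_neq0.
  apply: (loc F^`M(0) 1 2 (-1)) => //.
  have := curveP _ (hF 0) FXP0.
  rewrite X2 !hevalU /= !divr1 Dy rmorphN1 (heval_dX kK) => fX0.
  by field.
(* At infinity only (1 : 0 : 0) and (0 : 1 : 0) remain, where F_Y = X^(k+1) and F_Z = Y^(k+1)
   respectively are nonzero. *)
have /eqP : P 0 ^+ k.+1 * P 1 = 0.
  by rewrite -FPE P2 expr0n /= !(mulr0, mul0r) !addr0.
rewrite mulf_eq0 expf_eq0 /= => P01.
have [P0|P0] := eqVneq (P 0) 0; last first.
  have FYP0 : F^`M(1).@[P] != 0.
    by rewrite FYP P2 mulr0 addr0 expf_neq0.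
  apply: (loc F^`M(1) 2 0 (-1)) => //.
  rewrite X2 !hevalU /= (heval_dY kK) (derivation_div hD) //.
  rewrite (derivation1 hD) Dx rmorphN1 /GRing.scale /=.
  by field; rewrite x0 (fY_neq0 hL).
have P1 : P 1 != 0.
  by move: Pi0; have [->|->|->] := ord3P i0; rewrite ?P0 ?P2 ?eqxx.
have FZP0 : F^`M(2).@[P] != 0.
  by rewrite FZP P2 expr0n gtn_eqF // mul0r addr0 expf_neq0.
apply: (loc F^`M(2) 0 1 (-1)) => //.
have := curveP _ (hF 2) FZP0.
rewrite !hevalU /= (heval_dZ kK) (derivation_div hD) // => fZ0.
have -> : y ^- 2 *: (y *: D x - x *: D y) = - (fZ / y ^+ 2) :> L^o.
  rewrite Dx Dy /GRing.scale /= -[fZ]opprK -[- fZ]add0r -(euler_curve hL).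
  by field.
by rewrite rmorphN1; field; rewrite y0.
Qed.

End HolomorphicForms.

(** * Forms and functions regular everywhere *)

Section AffineRegular.

Variables (K : closedFieldType) (k : nat).
Hypothesis k_gt0 : (0 < k)%N.

Local Notation F := (hurwitz K k.+1).

Variables (L : fieldType) (iota : {rmorphism K -> L}) (x y : L).
Hypothesis hL : function_field iota F x y.

Local Notation hv := (heval iota x y).

Definition coord (h : L) := exists A, h = hv A.

Lemma coord_heval A : coord (hv A). Proof. by exists A. Qed.

Lemma coordC c : coord (iota c). Proof. by exists c%:MP; rewrite hevalC. Qed.

Lemma coord_x : coord x. Proof. by exists 'X_0; rewrite hevalU. Qed.

Lemma coord_y : coord y. Proof. by exists 'X_1; rewrite hevalU. Qed.

Lemma coordD f g : coord f -> coord g -> coord (f + g).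
Proof. by move=> [A ->] [B ->]; exists (A + B); rewrite rmorphD. Qed.

Lemma coordN f : coord f -> coord (- f).
Proof. by move=> [A ->]; exists (- A); rewrite rmorphN. Qed.

Lemma coordB f g : coord f -> coord g -> coord (f - g).
Proof. by move=> hf hg; apply/coordD/coordN. Qed.

Lemma coordM f g : coord f -> coord g -> coord (f * g).
Proof. by move=> [A ->] [B ->]; exists (A * B); rewrite rmorphM. Qed.

Lemma coordX f n : coord f -> coord (f ^+ n).
Proof. by move=> [A ->]; exists (A ^+ n); rewrite rmorphXn. Qed.

Lemma coord_sum I (r : seq I) (E : I -> L) :
  (forall i, coord (E i)) -> coord (\sum_(i <- r) E i).
Proof.
move=> hE; elim/big_rec: _ => [|i f _]; last exact: coordD.
by rewrite -(rmorph0 iota); apply: coordC.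
Qed.

Lemma coord_horner (q : {poly L}) h :
  (forall i, coord q`_i) -> coord h -> coord q.[h].
Proof.
move=> hq hh; rewrite horner_coef; apply: coord_sum => i.
by apply: coordM => //; apply: coordX.
Qed.

Definition horner_x : {rmorphism {poly K} -> L} :=
  horner_morph (fun a => mulrC x (iota a)).

Lemma coord_horner_x u : coord (horner_x u).
Proof.
apply: coord_horner coord_x => i; rewrite coef_map; exact: coordC.
Qed.

(** The equation of the curve is monic of degree k + 1 in y over K[x]. *)
Lemma integral_heval A : integralOver horner_x (hv A).
Proof.
have intx : integralOver horner_x x.
  by have := integral_id horner_x 'X; rewrite /= horner_morphX.
have intC c : integralOver horner_x (iota c).
  by have := integral_id horner_x c%:P; rewrite /= horner_morphC.
have inty : integralOver horner_x y.
  pose r := (x ^+ k.+1) *: 'X + x%:P : {poly L}.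
  have szr : (size r < k.+2)%N.
    rewrite (leq_ltn_trans (size_polyD _ _)) // gtn_max size_polyC.
    rewrite (leq_ltn_trans (size_scale_leq _ _)) ?size_polyX //.
    by case: eqP.
  apply: (@integral_root_monic _ _ _ _ ('X^(k.+1) + r)).
  - by rewrite monicE lead_coefDl ?size_polyXn ?lead_coefXn.
  - rewrite /root !hornerE /= -[X in _ == X](curve_equation hL).
    by apply/eqP; ring.
  - apply/integral_poly => i.
    rewrite coefD coefXn coefD coefZ coefX coefC.
    apply: integral_add; first exact: integral_nat.
    apply: integral_add; last by case: eqP => _; [exact: intx|exact: integral0].
    apply: integral_mul; last exact: integral_nat.
    have -> : x ^+ k.+1 = horner_x 'X^(k.+1).
      by rewrite rmorphXn /= horner_morphX.
    exact: integral_id.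
elim/mpolyind: A => [|c m A _ _ IHA].
  by rewrite rmorph0; apply: integral0.
rewrite rmorphD; apply: integral_add IHA; rewrite /= hevalZ heval_monomial.
have intX z n : integralOver horner_x z -> integralOver horner_x (z ^+ n).
  move=> intz; elim: n => [|n IHn]; first exact: integral1.
  by rewrite exprS; apply: integral_mul.
by apply: integral_mul => //; apply: integral_mul; apply: intX.
Qed.

(** In a monic equation for the denominator B over K[x], cancel powers of B until the constant term
    is nonzero; that term is then a multiple of B in K[x, y]. *)
Lemma denominator_x g : exists2 u, u != 0 & coord (horner_x u * g).
Proof.
case: hL => _ /(_ g)[e [A [B [_ _ b0 ->]]]].
suff [u u0 [C uE]] : exists2 u, u != 0 & exists C, horner_x u = hv C * hv B.
  exists u => //; exists (C * A).
  by rewrite uE rmorphM /=; field; exact: b0.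
have [q /monic_neq0 q0 qb] := integral_heval B.
elim/poly_ind: q q0 qb => [|q c IHq] q0; first by rewrite eqxx in q0.
rewrite rmorphD rmorphM /= map_polyX map_polyC /root !hornerE /=.
have [c0|c0 /eqP qb] := eqVneq c 0.
  rewrite c0 rmorph0 addr0 mulf_eq0 (negPf b0) orbF; apply: IHq.
  by apply: contraNneq q0 => ->; rewrite mul0r add0r c0.
exists c => //.
have [C qE] : coord (map_poly horner_x q).[hv B].
  apply: coord_horner (coord_heval _) => i; rewrite coef_map.
  exact: coord_horner_x.
exists (- C); rewrite rmorphN mulNr /= -qE; apply/eqP.
by rewrite -addr_eq0 addrC qb.
Qed.

(** The ideal of denominators of h lies in no maximal ideal of an affine point. Denominators need
    not be homogeneous, and the condition is stable under multiplication by K[x, y]. *)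
Definition affine_regular h := forall P, P 2 = 1 -> on_curve F P ->
  exists2 B, B.@[P] != 0 & coord (hv B * h).

Lemma affine_regularM f h :
  coord f -> affine_regular h -> affine_regular (f * h).
Proof.
move=> hf hh P P2 hP; have [B B0 Bh] := hh P P2 hP; exists B => //.
by rewrite mulrCA; apply: coordM.
Qed.

Lemma coord_subX f c n : coord f ->
  exists2 g, coord g & f ^+ n - iota c ^+ n = (f - iota c) * g.
Proof.
move=> hf; rewrite subrXX.
exists (\sum_(i < n) f ^+ (n.-1 - i) * iota c ^+ i) => //.
apply: coord_sum => i; apply: coordM; first exact: coordX.
by rewrite -rmorphXn; apply: coordC.
Qed.

Lemma heval_sub_meval A P : P 2 = 1 -> exists g1 g2,
  [/\ coord g1, coord g2
    & hv A - iota A.@[P] = (x - iota (P 0)) * g1 + (y - iota (P 1)) * g2].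
Proof.
move=> P2; elim/mpolyind: A => [|c m A _ _ [g1 [g2 [hg1 hg2 eqA]]]].
  exists 0, 0; rewrite -(rmorph0 iota); split; try exact: coordC.
  by rewrite meval0 !rmorph0 subrr !mulr0 addr0.
have [f1 hf1 eq1] := coord_subX (P 0) (m 0) coord_x.
have [f2 hf2 eq2] := coord_subX (P 1) (m 1) coord_y.
exists (iota c * (f1 * y ^+ m 1) + g1).
exists (iota c * (iota (P 0) ^+ m 0 * f2) + g2).
have [cx cy] := (coord_x, coord_y).
split.
- by apply/coordD/hg1/coordM/coordM/coordX/cy => //; apply: coordC.
- apply/coordD/hg2/coordM/coordM/hf2; first exact: coordC.
  by rewrite -rmorphXn; apply: coordC.
have mE : 'X_[m].@[P] = P 0 ^+ m 0 * P 1 ^+ m 1.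
  by rewrite mevalX big_ord3 /= P2 expr1n mulr1.
rewrite mevalD mevalZ mE rmorphD /= hevalZ heval_monomial !rmorphD !rmorphM /=.
rewrite !rmorphXn /= -[RHS]/(_ * (_ + g1) + _ * (_ + g2)).
transitivity (iota c * ((x ^+ m 0 - iota (P 0) ^+ m 0) * y ^+ m 1
   + iota (P 0) ^+ m 0 * (y ^+ m 1 - iota (P 1) ^+ m 1))
   + (hv A - iota A.@[P])).
  by ring.
by rewrite eq1 eq2 eqA; ring.
Qed.

(** The scalar B(P) is nonzero and equals B - (B - B(P)), where B - B(P) lies in the ideal generated
    by x - a and y - b, with (a, b) the affine coordinates of P. Both parts multiply h into
    K[x, y]. *)
Lemma affine_regular_base h P : P 2 = 1 -> on_curve F P -> affine_regular h ->
  coord ((x - iota (P 0)) * h) -> coord ((y - iota (P 1)) * h) -> coord h.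
Proof.
move=> P2 hP hh hx hy; have [B B0 Bh] := hh P P2 hP.
have [g1 [g2 [hg1 hg2 eqB]]] := heval_sub_meval B P2.
have -> : h = iota (B.@[P]^-1) * (hv B * h - (g1 * ((x - iota (P 0)) * h) +
    g2 * ((y - iota (P 1)) * h))).
  rewrite fmorphV; apply: (canRL (mulKf _)); first by rewrite fmorph_eq0.
  transitivity (hv B * h - (hv B - iota B.@[P]) * h); first by ring.
  by rewrite eqB; ring.
apply: coordM (coordC _) _; apply: coordB Bh _.
by apply: coordD; apply: coordM.
Qed.

(** Each factor is removed from the product of h with the factors still to come, which is why [Q]
    must be stable under multiplication by K[x, y]. *)
Lemma coord_peel (Q : L -> Prop) w (r : seq K) : coord w ->
    (forall f h, coord f -> Q h -> Q (f * h)) ->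
    (forall h z, z \in r -> Q h -> coord ((w - iota z) * h) -> coord h) ->
  forall h, Q h -> coord (\prod_(z <- r) (w - iota z) * h) -> coord h.
Proof.
move=> hw QM; elim: r => [|z r IHr] peel h Qh; first by rewrite big_nil mul1r.
rewrite big_cons -mulrA => hh.
apply: IHr => // [h' z' rz'|].
  by apply: peel; rewrite inE rz' orbT.
apply: (peel _ z); rewrite ?mem_head //.
apply: QM => //; elim/big_rec: _ => [|i f _ hf].
  by rewrite -(rmorph1 iota); apply: coordC.
by apply: coordM hf; apply: coordB => //; apply: coordC.
Qed.

(* f(a, Y) is monic in Y and f(a, y) is a multiple of x - a, so f(a, y) h is in
   K[x, y]; peel off its factors y - b, where (a, b) is a point of the curve. *)
Lemma affine_regular_line h a : affine_regular h ->
  coord ((x - iota a) * h) -> coord h.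
Proof.
move=> hh hx.
pose q : {poly K} := 'X^(k.+1) + (a ^+ k.+1 *: 'X + a%:P).
have [r qE] := closed_field_poly_normal q.
have q1 : lead_coef q = 1.
  rewrite lead_coefDl ?lead_coefXn // size_polyXn.
  rewrite (leq_ltn_trans (size_polyD _ _)) // gtn_max size_polyC.
  rewrite (leq_ltn_trans (size_scale_leq _ _)) ?size_polyX //.
  by case: eqP.
rewrite q1 scale1r in qE.
pose Q h := affine_regular h /\ coord ((x - iota a) * h).
apply: (@coord_peel Q y r) => // [|f h' hf [hh' hx']|h' z rz [hh' hx'] hz|].
- exact: coord_y.
- by split; [apply: affine_regularM | rewrite mulrCA; apply: coordM].
- pose P (i : 'I_3) := [:: a; z; 1]`_i.
  apply: (@affine_regular_base h' P) => //.
  split; first by exists 2; rewrite /P /= oner_neq0.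
  have : root q z by rewrite qE root_prod_XsubC.
  rewrite /root /q !hornerE /= => /eqP qz.
  rewrite meval_hurwitz /P /=.
  by rewrite -[RHS]qz expr1n mulr1; ring.
have -> : \prod_(z <- r) (y - iota z) = (map_poly iota q).[y].
  rewrite qE rmorph_prod horner_prod; apply: eq_bigr => z _.
  by rewrite rmorphB /= map_polyX map_polyC !hornerE /=.
have -> : (map_poly iota q).[y] = y ^+ k.+1 + (iota a ^+ k.+1 * y + iota a).
  rewrite /q !rmorphD /= linearZ /= map_polyXn map_polyX map_polyC !hornerE /=.
  by rewrite rmorphXn.
have [g hg eqg] := coord_subX a k.+1 coord_x.
have -> : (y ^+ k.+1 + (iota a ^+ k.+1 * y + iota a)) * h =
    - ((g * y + 1) * ((x - iota a) * h)).
  transitivity ((y ^+ k.+1 + (iota a ^+ k.+1 * y + iota a)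
    - (x ^+ k.+1 * y + y ^+ k.+1 + x)) * h).
    by rewrite (curve_equation hL) subr0.
  transitivity (- ((x ^+ k.+1 - iota a ^+ k.+1) * y + (x - iota a)) * h).
    by ring.
  by rewrite eqg; ring.
apply/coordN/coordM => //; apply: coordD; first exact/coordM/coord_y.
by rewrite -(rmorph1 iota); apply: coordC.
Qed.

Lemma affine_regular_coord g : affine_regular g -> coord g.
Proof.
move=> hg; have [u u0 hu] := denominator_x g.
have [r uE] := closed_field_poly_normal u.
apply: (@coord_peel affine_regular x r) => //.
- exact: coord_x.
- exact: affine_regularM.
- by move=> h z _; apply: affine_regular_line.
have -> : \prod_(z <- r) (x - iota z) = iota ((lead_coef u)^-1) * horner_x u.
  rewrite /= /horner_morph [X in map_poly _ X]uE linearZ /= hornerZ.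
  rewrite rmorph_prod horner_prod.
  rewrite mulrA -rmorphM mulVf ?lead_coef_eq0 // rmorph1 mul1r.
  by apply: eq_bigr => z _; rewrite rmorphB /= map_polyX map_polyC !hornerE /=.
by rewrite -mulrA; apply: coordM => //; apply: coordC.
Qed.

End AffineRegular.

(** * Degree bounds from the points at infinity *)

Section DegreeDescent.

Variables (K : fieldType) (k : nat).
Hypothesis k_gt0 : (0 < k)%N.

Local Notation F := (hurwitz K k.+1).

Variables (L : fieldType) (iota : {rmorphism K -> L}) (x y : L).
Hypothesis hL : function_field iota F x y.

Local Notation hv := (heval iota x y).

Definition form_value m (h : L) := exists2 A, A \is m.-homog & h = hv A.

Lemma form_value0 m : form_value m 0.
Proof. by exists 0; rewrite ?rpred0 ?rmorph0. Qed.

Lemma form_valueD m f g :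
  form_value m f -> form_value m g -> form_value m (f + g).
Proof.
move=> [A hA ->] [B hB ->]; exists (A + B); first exact: rpredD.
by rewrite rmorphD.
Qed.

Lemma form_valueZ m c f : form_value m f -> form_value m (iota c * f).
Proof.
move=> [A hA ->]; exists (c *: A); first exact: dhomogZ.
by rewrite hevalZ.
Qed.

Lemma form_valueN m f : form_value m f -> form_value m (- f).
Proof. by move=> /(form_valueZ (-1)); rewrite rmorphN1 mulN1r. Qed.

Lemma form_value_le m m' h : (m <= m')%N -> form_value m h -> form_value m' h.
Proof.
move=> le_mm' [A hA ->]; exists ('X_2 ^+ (m' - m) * A).
  by rewrite -[X in X.-homog](subnK le_mm'); apply: dhomogM; rewrite ?dhomogUn.
by rewrite rmorphM rmorphXn /= hevalU /= expr1n mul1r.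
Qed.

Lemma form_value_monomial a b m : (a + b <= m)%N ->
  form_value m (x ^+ a * y ^+ b).
Proof.
move=> le_ab; exists ('X_0 ^+ a * 'X_1 ^+ b * 'X_2 ^+ (m - (a + b))).
  rewrite -[X in X.-homog](subnKC le_ab).
  by apply: dhomogM; [apply: dhomogM|]; apply: dhomogUn.
by rewrite !rmorphM !rmorphXn /= !hevalU /= expr1n mulr1.
Qed.

Lemma form_value_sum m (I : eqType) (r : seq I) (E : I -> L) :
    (forall i, i \in r -> form_value m (E i)) ->
  form_value m (\sum_(i <- r) E i).
Proof.
move=> hE; rewrite big_seq.
elim/big_rec: _ => [|i f ri]; first exact: form_value0.
by apply: form_valueD; apply: hE.
Qed.

Lemma form_value_heval A : form_value (msize A) (hv A).
Proof.
rewrite hevalE; apply: form_value_sum => m mA; apply/form_valueZ.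
apply: form_value_monomial; apply: leq_trans (ltnW (msize_mdeg_lt mA)).
by rewrite mdeg3 leq_addr.
Qed.

(* Restriction of a form to the line Z = 0, with the affine coordinate X or Y
   according to the index i. *)
Definition line_point (i l : 'I_3) : {poly K} :=
  if l == 2 then 0 else if l == i then 'X else 1.

Definition line_eval i (A : {mpoly K[3]}) : {poly K} :=
  mmap polyC (line_point i) A.

HB.instance Definition _ i :=
  GRing.RMorphism.copy (line_eval i) (mmap polyC (line_point i)).

Lemma line_evalU i l : line_eval i 'X_l = line_point i l.
Proof. by rewrite /line_eval mmapX mmap1U. Qed.

Lemma line_eval_horner0 i A :
  (line_eval i A).[0] = A.@[fun l => (line_point i l).[0]].
Proof.
elim/mpolyind: A => [|c m A _ _ IHA]; first by rewrite rmorph0 horner0 meval0.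
rewrite rmorphD hornerD /= mevalD IHA; congr (_ + _).
rewrite /line_eval mmapZ mmapX hornerM hornerC mevalZ mevalX horner_prod.
by congr (_ * _); apply: eq_bigr => l _; rewrite horner_exp.
Qed.

(** Among monomials of degree e without Z, the exponent at i determines the other one, so
    dehomogenising the restriction merges no coefficients. *)
Lemma coef_line_eval (i : 'I_3) e (A : {mpoly K[3]}) (m : 'X_{1..3}) :
  i != 2 -> A \is e.-homog -> m 2 = 0%N -> mdeg m = e ->
  (line_eval i A)`_(m i) = A@_m.
Proof.
move=> i2 hA m2 dm; rewrite /line_eval /mmap coef_sum.
have mP m' : mdeg m' = e -> m' 2 = 0%N -> m' i = m i -> m' = m.
  rewrite -dm !mdeg3 m2 !addn0 => eqd m'2 eqi; apply/mnmP => l.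
  have [l2|l2] := eqVneq l 2; first by rewrite l2 m2 m'2.
  have [->|li] := eqVneq l i; first by [].
  move: i2 l2 li eqi eqd; rewrite m'2 addn0.
  by have [->|->|->] := ord3P i; have [->|->|->] := ord3P l => // _ _ _ -> eqd;
    first [exact: addnI eqd | exact: addIn eqd].
have term m' : m' \in msupp A ->
    ((A@_m')%:P * mmap1 (line_point i) m')`_(m i) = A@_m' * (m' == m)%:R.
  move=> m'A; rewrite coefCM /mmap1; congr (_ * _).
  have dm' := dhomog_mf hA m'A.
  have [->|nm] := eqVneq m' m.
    have -> : \prod_l line_point i l ^+ m l = 'X^(m i).
      rewrite (bigD1 i) //= big1 ?mulr1 /line_point ?(negPf i2) ?eqxx //.
      move=> l li.
      by case: (eqVneq l 2) => [->|_]; rewrite ?m2 // (negPf li) expr1n.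
    by rewrite coefXn eqxx.
  have [m'2|m'2] := eqVneq (m' 2) 0%N; last first.
    by rewrite (bigD1 2) //= /line_point eqxx expr0n (negPf m'2) mul0r coef0.
  have -> : \prod_l line_point i l ^+ m' l = 'X^(m' i).
    rewrite (bigD1 i) //= big1 ?mulr1 /line_point ?(negPf i2) ?eqxx // => l li.
    by case: (eqVneq l 2) => [->|_]; rewrite ?m'2 // (negPf li) expr1n.
  rewrite coefXn; case: eqP => // eqi.
  by rewrite (mP m') ?eqxx // in nm.
rewrite big_seq; under eq_bigr => m' m'A do rewrite term //.
rewrite -big_seq; have [mA|mA] := boolP (m \in msupp A).
  rewrite (bigD1_seq m) ?msupp_uniq //= eqxx mulr1 big1 ?addr0 //.
  by move=> m' /negPf ->; rewrite mulr0.
rewrite big_seq big1 => [|m' m'A]; first by rewrite (memN_msupp_eq0 mA).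
by case: eqP => [eqm|_]; rewrite ?mulr0 // -eqm m'A in mA *.
Qed.

(** On the line Z = 0 the curve restricts to X^(k+1) Y; this is the order of vanishing at (0 : 1 :
    0) for i = 0 and at (1 : 0 : 0) for i = 1. *)
Definition line_order (i : 'I_3) := if i == 0 then k.+1 else 1.

Lemma line_eval_hurwitz i : i != 2 -> line_eval i F = 'X ^+ line_order i.
Proof.
rewrite !rmorphD !rmorphM !rmorphXn /= !line_evalU /line_point /line_order.
by have [->|->|->] := ord3P i; rewrite //=
  ?expr1n ?expr0n /= ?(mulr0, mul0r, addr0, mulr1, mul1r).
Qed.

Definition line_coords (i l : 'I_3) : K := ((l != 2) && (l != i))%:R.

(** The local form gives H A = Z^(m-j) G modulo [F]. On Z = 0 the right side disappears, so H A is
    divisible by the restriction of [F], a power of the coordinate; H is prime to it, being nonzero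
    at the point. *)
Lemma line_order_vanishing i j m A (mon : 'X_{1..3}) : i != 2 ->
    A \is m.-homog -> local_form iota x y (line_coords i) j (hv A) ->
    (j < m)%N -> mon 2 = 0%N -> mdeg mon = m -> (mon i < line_order i)%N ->
  A@_mon = 0.
Proof.
move=> i2 hA [e [G [H [hG hH H0 eqG]]]] lt_jm mon2 dmon lt_mon.
have [Q eqQ] : exists Q, H * A - 'X_2 ^+ (m - j) * G = Q * F.
  apply: (heval_eq0 hL (e := (e + m)%N)).
    apply: rpredB; first exact: dhomogM.
    rewrite -[X in (e + X)%N](subnK (ltnW lt_jm)) addnCA.
    by apply: dhomogM => //; apply: dhomogUn.
  by rewrite rmorphB !rmorphM rmorphXn /= hevalU /= expr1n mul1r eqG subrr.
rewrite -(coef_line_eval i2 hA mon2 dmon).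
have: 'X ^+ line_order i %| line_eval i H * line_eval i A.
  have <- : line_eval i (Q * F) = line_eval i H * line_eval i A.
    rewrite -eqQ rmorphB !rmorphM rmorphXn /= line_evalU /line_point eqxx.
    by rewrite expr0n subn_eq0 leqNgt lt_jm mul0r subr0.
  by rewrite rmorphM /= line_eval_hurwitz // dvdp_mull.
rewrite Gauss_dvdpr; last first.
  apply: coprimep_expl; rewrite coprimep_sym -['X]subr0 coprimep_XsubC.
  rewrite /root line_eval_horner0; apply: contraNneq H0 => <-.
  apply/eqP/meval_eq => l; rewrite /line_coords /line_point.
  by do 2!case: eqP => _; rewrite ?hornerX ?hornerC.
by case/dvdpP => q ->; rewrite coefMXn lt_mon.
Qed.

(* At the two points at infinity, the leading form of g is divisible by X^(k+1)
   and by Y; modulo F, X^(k+1) Y is a multiple of Z. *)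
Lemma form_value_descent m g : (k <= m)%N ->
    (forall i : 'I_3, i != 2 -> local_form iota x y (line_coords i) k.-1 g) ->
  form_value m g -> form_value m.-1 g.
Proof.
move=> le_km hloc [A hA gA]; rewrite gA hevalE.
have lt_m : (k.-1 < m)%N by rewrite prednK.
have van (i : 'I_3) (mon : 'X_{1..3}) : i != 2 -> mon 2 = 0%N -> mdeg mon = m ->
    (mon i < line_order i)%N -> A@_mon = 0.
  move=> i2; apply: line_order_vanishing hA _ lt_m => //.
  by rewrite -gA; apply: hloc.
apply: form_value_sum => mon monA; apply: form_valueZ.
have dmon : mdeg mon = m := dhomog_mf hA monA.
have := dmon; rewrite mdeg3; have [mon2|mon2] := posnP (mon 2); last first.
  move=> dmon3; apply: form_value_monomial.
  by rewrite -ltnS (ltn_predK lt_m) -dmon3 -[X in (X < _)%N]addn0 ltn_add2l.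
have nz (i : 'I_3) : i != 2 -> (line_order i <= mon i)%N.
  move=> i2; rewrite leqNgt; apply: contraL monA => lt_mon.
  by rewrite -mcoeff_eq0 (van i).
have := nz 0 isT; have := nz 1 isT; rewrite /line_order /=.
move: (mon 0) (mon 1) => a [//|b] _ le_ka; rewrite mon2 addn0 -(subnK le_ka).
move: (a - k.+1)%N => c eqm.
have -> : x ^+ (c + k.+1) * y ^+ b.+1 =
    - (x ^+ c * y ^+ (b.+1 + k) + x ^+ c.+1 * y ^+ b).
  apply/eqP; rewrite -addr_eq0 -[X in _ == X](mulr0 (x ^+ c * y ^+ b)).
  by rewrite -(curve_equation hL) !exprD !exprS; apply/eqP; ring.
apply/form_valueN/form_valueD; apply: form_value_monomial; lia.
Qed.

Lemma form_value_line_regular g :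
    (forall i : 'I_3, i != 2 -> local_form iota x y (line_coords i) k.-1 g) ->
  (exists A, g = hv A) -> form_value k.-1 g.
Proof.
move=> hloc [A gA]; have := form_value_heval A; rewrite -gA.
elim: (msize A) => [|m IHm] hm; first exact: form_value_le hm.
have [le_km|lt_mk] := leqP k m.+1.
  exact: IHm (form_value_descent le_km hloc hm).
by apply: form_value_le hm; rewrite -ltnS prednK.
Qed.

End DegreeDescent.

Section HolomorphicCharacterization.

Variables (K : closedFieldType) (k : nat).
Hypotheses (kK : k%:R = 0 :> K) (k_gt0 : (0 < k)%N).

Local Notation F := (hurwitz K k.+1).

Variables (L : fieldType) (iota : {rmorphism K -> L}) (x y : L).
Hypothesis hL : function_field iota F x y.

Local Notation fY := (x ^+ k.+1 + y ^+ k).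

Lemma holomorphic_form_value (Omega : lmodType L) (d : L -> Omega) omega :
  kaehler iota d -> holomorphic iota d F x y omega ->
  exists2 g, form_value iota x y k.-1 g & omega = g *: (fY^-1 *: d x).
Proof.
move=> hd /(holomorphic_local_form kK k_gt0 hL hd)[g -> hg]; exists g => //.
apply: (form_value_line_regular k_gt0 hL) => [i i2|].
  apply: hg; split; last first.
    rewrite meval_hurwitz /line_coords.
    move: i2; have [->|->|->] := ord3P i => //= _;
      by rewrite ?mulr1n ?mulr0n !expr0n /= !(mulr0, mul0r, addr0).
  move: i2; have [->|->|->] := ord3P i => // _; [exists 1|exists 0];
    by rewrite /line_coords /= oner_neq0.
apply: (affine_regular_coord k_gt0 hL) => P _ /hg[e [A [B [_ _ B0 eqA]]]].
by exists B => //; exists A.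
Qed.

End HolomorphicCharacterization.

(** * Exact differentials *)

Lemma prime_dvd_fact p n : prime p -> (p %| n`!)%N = (p <= n)%N.
Proof.
move=> p_pr; elim: n => [|n IHn].
  by rewrite dvdn1 leqn0 !gtn_eqF ?prime_gt0 ?prime_gt1.
rewrite factS Euclid_dvdM // IHn; apply/orP/idP => [[/dvdn_leq->//|/leqW//]|].
by rewrite leq_eqVlt => /predU1P[->|?]; [left | right].
Qed.

Section Exactness.

Variables (K : closedFieldType) (p s : nat).
Hypothesis hp : p \in [pchar K].

Local Notation k := (s * p)%N.
Local Notation F := (hurwitz K k.+1).

Variables (L : fieldType) (iota : {rmorphism K -> L}) (x y : L).
Hypothesis hL : function_field iota F x y.

Local Notation hv := (heval iota x y).
Local Notation fY := (x ^+ k.+1 + y ^+ k).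

Let p_prime : prime p. Proof. exact: pcharf_prime hp. Qed.
Let p_gt0 : (0 < p)%N. Proof. exact: prime_gt0. Qed.
Let hpL : p \in [pchar L]. Proof. exact: rmorph_pchar hp. Qed.
Let x0 : x != 0. Proof. exact: x_neq0 hL. Qed.
Let y0 : y != 0. Proof. exact: y_neq0 hL. Qed.

Definition ppower (h : L) := exists z, h = z ^+ p.

Lemma ppowerX z : ppower (z ^+ p). Proof. by exists z. Qed.

Lemma exists_pth_root (c : K) : exists r, r ^+ p == c.
Proof.
have [r] := @solve_monicpoly K p (fun i => if i == 0%N then c else 0) p_gt0.
rewrite (bigD1 (Ordinal p_gt0)) //= expr0 mulr1 big1 => [|i i0].
  by rewrite addr0 => rE; exists r; rewrite rE.
by rewrite ifN ?mul0r //; apply: contraNneq i0 => i0; apply/eqP.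
Qed.

Lemma ppowerC c : ppower (iota c).
Proof.
have [r /eqP <-] := exists_pth_root c.
by exists (iota r); rewrite rmorphXn.
Qed.

Lemma ppower0 : ppower 0.
Proof. by rewrite -(rmorph0 iota); apply: ppowerC. Qed.

Lemma ppower1 : ppower 1.
Proof. by rewrite -(rmorph1 iota); apply: ppowerC. Qed.

Lemma ppowerD f g : ppower f -> ppower g -> ppower (f + g).
Proof.
move=> [u ->] [v ->]; exists (u + v).
by rewrite -!(pFrobenius_autE hpL) rmorphD.
Qed.

Lemma ppowerM f g : ppower f -> ppower g -> ppower (f * g).
Proof. by move=> [u ->] [v ->]; exists (u * v); rewrite exprMn. Qed.

Lemma ppower_nat n : ppower n%:R.
Proof. by rewrite -(rmorph_nat iota); apply: ppowerC. Qed.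

Lemma ppower_sum I (r : seq I) (P : pred I) (E : I -> L) :
  (forall i, P i -> ppower (E i)) -> ppower (\sum_(i <- r | P i) E i).
Proof.
by move=> hE; apply: big_ind => //; [apply: ppower0 | apply: ppowerD].
Qed.

Definition ppower_poly (q : {poly L}) := forall i, ppower q`_i.

Lemma ppower_polyC c : ppower c -> ppower_poly c%:P.
Proof. by move=> hc i; rewrite coefC; case: eqP => // _; apply: ppower0. Qed.

Lemma ppower_polyXn n : ppower_poly 'X^n.
Proof. by move=> i; rewrite coefXn; apply: ppower_nat. Qed.

Lemma ppower_polyD q r : ppower_poly q -> ppower_poly r -> ppower_poly (q + r).
Proof. by move=> hq hr i; rewrite coefD; apply: ppowerD. Qed.

Lemma ppower_polyM q r : ppower_poly q -> ppower_poly r -> ppower_poly (q * r).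
Proof.
by move=> hq hr i; rewrite coefM; apply: ppower_sum => j _; apply: ppowerM.
Qed.

Lemma ppower_polyN q : ppower_poly q -> ppower_poly (- q).
Proof.
move=> hq i; rewrite coefN -mulN1r; apply: ppowerM => //.
by rewrite -(rmorphN1 iota); apply: ppowerC.
Qed.

Lemma ppower_polyX q n : ppower_poly q -> ppower_poly (q ^+ n).
Proof.
move=> hq; elim: n => [|n IHn]; last by rewrite exprS; apply: ppower_polyM.
by rewrite expr0; apply: ppower_polyC ppower1.
Qed.

Lemma ppower_poly_sum I (r : seq I) (P : pred I) (E : I -> {poly L}) :
  (forall i, P i -> ppower_poly (E i)) ->
  ppower_poly (\sum_(i <- r | P i) E i).
Proof. by move=> hE i; rewrite coef_sum; apply: ppower_sum => j /hE. Qed.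

Lemma ppower_poly_deriv q : ppower_poly q -> ppower_poly q^`().
Proof.
move=> hq i; rewrite coef_deriv -mulr_natr; apply: ppowerM => //.
exact: ppower_nat.
Qed.

Local Notation v := (x^-1).

(* 1 / y is affine in v = 1 / x with p-th powers as coefficients. *)
Definition inv_y_poly : {poly L} := - ((x ^+ s) ^+ p)%:P - (y ^+ s) ^+ p *: 'X.

Lemma inv_y_polyE : inv_y_poly.[v] = y^-1.
Proof.
rewrite /inv_y_poly !hornerE /= -!exprM.
apply: (mulfI y0); rewrite mulfV //; apply: (mulfI x0).
rewrite mulr1 -[RHS]opprK -(yfY hL) exprS; by field.
Qed.

Lemma ppower_inv_y_poly : ppower_poly inv_y_poly.
Proof.
apply: ppower_polyD; first exact/ppower_polyN/ppower_polyC/ppowerX.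
apply: ppower_polyN; rewrite -mul_polyC.
by apply: ppower_polyM (ppower_polyXn 1); apply/ppower_polyC/ppowerX.
Qed.

(** L^p[v] is closed under inverses, as 1 / g = g^(p-1) (1 / g)^p. It contains 1 / x and 1 / y,
    hence x and y, hence all of L. *)
Lemma ppower_poly_value f : exists2 Q, ppower_poly Q & f = Q.[v].
Proof.
pose T h := exists2 Q, ppower_poly Q & h = Q.[v].
have TC c : ppower c -> T c.
  by move=> hc; exists c%:P; [apply: ppower_polyC | rewrite hornerC].
have TD g h : T g -> T h -> T (g + h).
  move=> [Q hQ ->] [R hR ->]; exists (Q + R); first exact: ppower_polyD.
  by rewrite hornerD.
have TM g h : T g -> T h -> T (g * h).
  move=> [Q hQ ->] [R hR ->]; exists (Q * R); first exact: ppower_polyM.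
  by rewrite hornerM.
have TX g n : T g -> T (g ^+ n).
  move=> [Q hQ ->]; exists (Q ^+ n); first exact: ppower_polyX.
  by rewrite horner_exp.
have TV g : T g -> T g^-1.
  have [->|g0] := eqVneq g 0; first by rewrite invr0.
  move=> hg; have -> : g^-1 = g ^+ p.-1 * (g^-1) ^+ p.
    rewrite exprVn -{2}(prednK p_gt0) exprSr invfM mulrA mulfV ?mul1r //.
    exact: expf_neq0.
  by apply: TM; [apply: TX | apply/TC/ppowerX].
have Tx : T x.
  rewrite -[x]invrK; apply: TV.
  by exists 'X^1; [apply: ppower_polyXn | rewrite hornerX].
have Ty : T y.
  rewrite -[y]invrK; apply: TV; exists inv_y_poly; rewrite ?inv_y_polyE //.
  exact: ppower_inv_y_poly.
have Thv A : T (hv A).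
  rewrite hevalE; apply: (big_ind T) => // [|m _]; first exact/TC/ppower0.
  by apply: (TM); [apply/TC/ppowerC | apply: TM; apply: TX].
by case: hL => _ /(_ f)[e [A [B [_ _ _ ->]]]]; apply: TM (Thv A) (TV _ (Thv B)).
Qed.

Variable D : L -> L^o.
Hypotheses (hD : derivation iota D) (Dx : D x = fY).

Lemma derivation_inv_x : D v = (x * y)^-1.
Proof.
rewrite (derivationV hD) // Dx /GRing.scale /=.
have -> : fY = - (x / y) by apply: (mulfI y0); rewrite (yfY hL); field.
by field; rewrite x0 y0.
Qed.

Lemma derivation_inv_x_neq0 : D v != 0.
Proof. by rewrite derivation_inv_x invr_eq0 mulf_neq0. Qed.

Lemma inv_x_separating : separating p v.
Proof.
move=> [w vw]; move/eqP: derivation_inv_x_neq0; apply.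
by rewrite vw (derivation_pchar hD).
Qed.

Lemma derivation_ppower_poly Q : ppower_poly Q ->
  D Q.[v] = Q^`().[v] * D v.
Proof.
move=> hQ; rewrite horner_coef (derivation_sum hD).
rewrite (@horner_coef_wide _ (size Q).-1); last first.
  have [->|Q0] := eqVneq Q 0; first by rewrite deriv0 size_poly0.
  by rewrite -ltnS prednK ?lt_size_deriv // size_poly_gt0.
have DQ i : D (Q`_i * v ^+ i) = Q`_i * (i%:R * v ^+ i.-1 * D v).
  have [z ->] := hQ i.
  rewrite (derivationM hD) (derivation_pchar hD) // scaler0 addr0.
  by rewrite (derivationX hD).
rewrite mulr_suml; case: (size Q) => [|n]; first by rewrite !big_ord0.
rewrite big_ord_recl DQ mul0r mul0r mulr0 add0r /=; apply: eq_bigr => i _.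
rewrite DQ coef_deriv -mulr_natr /bump /= add1n; move: (D v : L) => Dv.
by ring.
Qed.

(** [D] kills the coefficients and D v is nonzero, so a relation satisfied by v over L^p may be
    differentiated formally. *)
Lemma ppower_poly_derivn_root Q n : ppower_poly Q -> Q.[v] = 0 ->
  Q^`(n).[v] = 0.
Proof.
move=> hQ Qv; suff [] : ppower_poly Q^`(n) /\ Q^`(n).[v] = 0 by [].
elim: n => [|n [hQn IHn]]; first by rewrite derivn0.
rewrite derivnS; split; first exact: ppower_poly_deriv.
have /eqP := derivation_ppower_poly hQn.
rewrite IHn (derivation0 hD) eq_sym mulf_eq0 (negPf derivation_inv_x_neq0) orbF.
by move/eqP.
Qed.

Lemma derivn_pchar (Q : {poly L}) : Q^`(p) = 0.
Proof.
apply/polyP => i; rewrite nderivn_def coefMn coef0 -mulr_natr.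
by apply/eqP; rewrite mulf_eq0 -(dvdn_pcharf hpL) dvdn_fact ?p_gt0 ?leqnn ?orbT.
Qed.

(** The coefficient at degree i carries the product of i + 1, ..., i + p - 1, which includes p when
    0 < i < p; the size bound removes i >= p. *)
Lemma derivn_pred_pchar (G : {poly L}) : (size G <= p + p.-1)%N ->
  G^`(p.-1) = (p.-1`!%:R * G`_p.-1)%:P.
Proof.
move=> szG; apply/polyP => i; rewrite coef_derivn coefC.
have [->|i0] := posnP i; first by rewrite addn0 ffactnn mulr_natl.
have [le_pi|lt_ip] := leqP p i.
  by rewrite nth_default ?mul0rn // (leq_trans szG) // addnC leq_add2l.
have /dvdnP[q ->] : (p %| (p.-1 + i) ^_ p.-1)%N.
  have : (p %| (p.-1 + i)`!)%N.
    by rewrite dvdn_fact // p_gt0 -{1}(prednK p_gt0) -addn1 leq_add2l.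
  rewrite -(@ffact_fact _ p.-1) ?leq_addr // addKn Euclid_dvdM // => /orP[//|].
  by rewrite prime_dvd_fact // leqNgt lt_ip.
by rewrite mulnC mulrnA -[_ *+ p]mulr_natr (pcharf0 hpL) mulr0 mul0rn.
Qed.

(* An exact differential is Q'(v) dv with Q over L^p, and the (p-1)-st
   derivative of Q' is Q^(p) = 0; that of G is (p-1)! G_(p-1). *)
Lemma exact_coef_eq0 G f : ppower_poly G -> (size G <= p + p.-1)%N ->
  D f = G.[v] * D v -> G`_p.-1 = 0.
Proof.
move=> hG szG Df; have [Q hQ fQ] := ppower_poly_value f.
have GQ : (G - Q^`()).[v] = 0.
  apply/eqP; rewrite hornerD hornerN subr_eq0.
  apply/eqP/(mulIf derivation_inv_x_neq0).
  by rewrite -derivation_ppower_poly // -fQ.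
have hGQ : ppower_poly (G - Q^`()).
  by apply/ppower_polyD/ppower_polyN/ppower_poly_deriv.
have := ppower_poly_derivn_root p.-1 hGQ GQ.
rewrite derivnB -derivSn prednK // derivn_pchar subr0.
rewrite derivn_pred_pchar // hornerC => /eqP; rewrite mulf_eq0 => /orP[|/eqP//].
by rewrite -(dvdn_pcharf hpL) prime_dvd_fact // leqNgt ltn_predL p_gt0.
Qed.

End Exactness.

Section MonomialIndependence.

Variables (K : fieldType) (k : nat).
Variables (L : fieldType) (iota : {rmorphism K -> L}) (x y : L).
Hypothesis hL : function_field iota (hurwitz K k.+1) x y.

Lemma monomials_independent (I : finType) (P : pred I) (al be : I -> nat)
    (c : I -> K) :
    (forall q, P q -> (al q + be q <= k.+1)%N) ->
    {in P &, injective (fun q => (al q, be q))} ->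
    \sum_(q | P q) iota (c q) * (x ^+ al q * y ^+ be q) = 0 ->
  forall q, P q -> c q = 0.
Proof.
move=> bnd inj sum0 q0 Pq0.
(* All monomials are homogenised to the common degree k + 1, the largest below deg F. *)
pose mon q := 
    [multinom nth 0%N [:: al q; be q; k.+1 - (al q + be q)]%N (i : 'I_3)
    | i < 3].
have monE q : [/\ mon q 0 = al q, mon q 1 = be q
    & mon q 2 = (k.+1 - (al q + be q))%N] by rewrite !mnmE.
pose A : {mpoly K[3]} := \sum_(q | P q) c q *: 'X_[mon q].
have A0 : A = 0.
  apply: (heval_low hL (leqnn k.+1)).
    apply: rpred_sum => q Pq; apply: dhomogZ; rewrite dhomogX /= mdeg3.
    by have [-> -> ->] := monE q; rewrite subnKC ?bnd.
  rewrite rmorph_sum -[RHS]sum0; apply: eq_bigr => q _ /=.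
  by rewrite hevalZ heval_monomial; have [-> -> _] := monE q.
have := congr1 (mcoeff (mon q0)) A0; rewrite mcoeff0 raddf_sum (bigD1 q0) //=.
rewrite mcoeffZ mcoeffX eqxx mulr1 big1 ?addr0 // => q /andP[Pq /negPf nq].
rewrite mcoeffZ mcoeffX; case: eqP => [eqm|_]; last by rewrite mulr0.
suff qq0 : q = q0 by rewrite qq0 eqxx in nq.
apply: inj => //; have [<- <- _] := monE q; have [<- <- _] := monE q0.
by rewrite eqm.
Qed.

End MonomialIndependence.

(** Either d z = 0 and omega is zero, or the term in z^(p-1) is missing and the others integrate one
    by one, since i + 1 is invertible for i < p - 1. *)
Lemma cartier_exact (K L : fieldType) (iota : {rmorphism K -> L}) (p : nat)
    (Omega : lmodType L) (d : L -> Omega) omega :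
  p \in [pchar L] -> derivation iota d -> cartier d p omega 0 ->
  exists f, omega = d f.
Proof.
move=> hpL hd [z [u [_ -> /esym/eqP]]]; rewrite scaler_eq0.
have p_gt0 : (0 < p)%N by apply: prime_gt0; apply: pcharf_prime hpL.
case/orP=> /eqP u0; last by exists 0; rewrite u0 scaler0 (derivation0 hd).
exists (\sum_(i < p.-1) iota (i.+1%:R^-1) * (u i ^+ p * z ^+ i.+1)).
rewrite -(big_mkord xpredT (fun i => u i ^+ p * z ^+ i)).
rewrite -[X in index_iota 0 X](prednK p_gt0) big_nat_recr //= big_mkord.
rewrite u0 expr0n gtn_eqF //= mul0r addr0.
rewrite (derivation_sum hd) scaler_suml; apply: eq_bigr => i _.
rewrite !(derivationM hd) (derivationC hd) scaler0 addr0.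
rewrite (derivation_pchar hd _ hpL) scaler0 addr0 (derivationX hd) !scalerA.
have i0 : i.+1%:R != 0 :> L.
  rewrite -(dvdn_pcharf hpL) gtnNdvd // -ltn_predRL; exact: ltn_ord.
congr (_ *: _); rewrite fmorphV rmorph_nat /=.
by move: (i.+1%:R) i0 => c c0; field.
Qed.

(** * Monomials as polynomials in v over p-th powers *)

Section MonoPoly.

Variables (K : closedFieldType) (p s : nat).
Hypothesis hp : p \in [pchar K].

Variables (L : fieldType) (iota : {rmorphism K -> L}) (x y : L).

Let p_gt0 : (0 < p)%N. Proof. exact/prime_gt0/pcharf_prime/hp. Qed.

Definition mono_poly (i j : nat) : {poly L} :=
  'X^(p.-1 - i) * inv_y_poly p s x y ^+ (p.-1 - j).

(** Both exponents are rounded up to the next multiple of p, the excess becoming powers of 1 / x and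
    1 / y. One factor 1 / (x y) is kept apart because it is D v. *)
Lemma mono_polyE (hL : function_field iota (hurwitz K (s * p).+1) x y)
    i1 j1 i0 j0 : (i0 < p)%N -> (j0 < p)%N ->
  x ^+ (i1 * p + i0) * y ^+ (j1 * p + j0) =
  (x ^+ i1.+1 * y ^+ j1.+1) ^+ p * (mono_poly i0 j0).[x^-1] * (x * y)^-1.
Proof.
move=> lt_i lt_j; have [x0 y0] := (x_neq0 hL, y_neq0 hL).
have aux (z : L) i1' i0' : z != 0 -> (i0' < p)%N ->
    z ^+ (i1' * p + i0') = z ^+ (i1'.+1 * p) * z^-1 ^+ (p.-1 - i0') * z^-1.
  move=> z0 lt_i'; rewrite -mulrA -exprSr exprVn.
  have -> : (i1'.+1 * p = i1' * p + i0' + (p.-1 - i0').+1)%N.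
    rewrite mulSnr -addnA -subSn ?prednK ?subnKC // ?(ltnW lt_i') //.
    by rewrite -ltnS prednK.
  by rewrite [X in X / _]exprD mulfK // expf_neq0.
rewrite /mono_poly hornerM hornerXn horner_exp (inv_y_polyE hL).
rewrite !(aux x, aux y) //.
by rewrite exprMn -!exprM invfM; ring.
Qed.

Lemma ppower_mono_poly i j : ppower_poly p (mono_poly i j).
Proof.
apply: (ppower_polyM hp iota) (ppower_polyXn hp iota _) _.
apply: (ppower_polyX hp iota); exact: (ppower_inv_y_poly s hp iota).
Qed.

Lemma size_mono_poly i j :
  (size (mono_poly i j) <= ((p.-1 - i) + (p.-1 - j)).+1)%N.
Proof.
rewrite /mono_poly; have [->|w0] := eqVneq (inv_y_poly p s x y ^+ (p.-1 - j)) 0.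
  by rewrite mulr0 size_poly0.
rewrite mulrC size_mulXn // -addnS leq_add2l.
apply: leq_trans (size_poly_exp_leq _ _) _; rewrite ltnS.
rewrite -[X in (_ <= X)%N]mul1n leq_mul // -subn1 leq_subLR.
rewrite (leq_trans (size_polyD _ _)) // geq_max !size_polyN.
rewrite (leq_trans (size_polyC_leq1 _)) //=.
by rewrite (leq_trans (size_scale_leq _ _)) ?size_polyX.
Qed.

Lemma coef_affine_exp (a b : L) n i :
  ((a%:P + b *: 'X) ^+ n)`_i = (a ^+ (n - i) * b ^+ i) *+ 'C(n, i).
Proof.
rewrite exprDn coef_sum.
under eq_bigr => j _ do rewrite coefMn -polyC_exp exprZn coefCM coefZ coefXn.
have [le_in|lt_ni] := leqP i n.
  rewrite (bigD1 (Ordinal (le_in : (i < n.+1)%N))) //= eqxx mulr1.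
  rewrite big1 ?addr0 // => j nj; rewrite (_ : (i == j) = false).
    by rewrite !mulr0 mul0rn.
  by apply/negbTE; rewrite eq_sym.
rewrite bin_small // mulr0n big1 // => j _.
rewrite gtn_eqF ?mulr0 ?mul0rn //; apply: leq_trans (ltn_ord j) _.
by [].
Qed.

Definition mono_coef (i j : nat) : K :=
  (-1) ^+ (p.-1 - j) * 'C(p.-1 - j, i)%:R.

(** The binomial divides (p - 1 - j)!, a factorial prime to p. *)
Lemma mono_coef_neq0 i j : (i + j < p)%N -> mono_coef i j != 0.
Proof.
move=> lt_ij; rewrite mulf_neq0 ?signr_eq0 // -(dvdn_pcharf hp).
have le_i : (i <= p.-1 - j)%N by lia.
apply/negP => /(dvdn_mulr (i`! * (p.-1 - j - i)`!)).
rewrite bin_fact // prime_dvd_fact ?(pcharf_prime hp) //; lia.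
Qed.

Lemma mono_coef_eq0 i j : (p <= i + j)%N -> (j < p)%N -> mono_coef i j = 0.
Proof. by move=> le_p lt_j; rewrite /mono_coef bin_small ?mulr0 //; lia. Qed.

(** The factor v^(p-1-i) leaves the coefficient of v^i in a power of an affine polynomial, given by
    the binomial theorem. *)
Lemma coef_mono_poly i j : (i < p)%N -> (mono_poly i j)`_p.-1 =
  iota (mono_coef i j) *
    (x ^+ (s * (p.-1 - j - i)) * y ^+ (s * i)) ^+ p.
Proof.
move=> lt_i; have le_i : (i <= p.-1)%N by lia.
rewrite /mono_poly coefXnM ltnNge leq_subr /= subKn //.
have -> : inv_y_poly p s x y = (- (x ^+ s) ^+ p)%:P + (- (y ^+ s) ^+ p) *: 'X.
  by rewrite /inv_y_poly polyCN scaleNr.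
rewrite coef_affine_exp /mono_coef; move: (p.-1 - j)%N => n.
have [le_in|lt_ni] := leqP i n; last first.
  by rewrite bin_small // mulr0n mulr0 rmorph0 mul0r.
rewrite rmorphM rmorph_nat rmorphXn rmorphN1 /= -mulr_natr.
rewrite [(- (x ^+ s) ^+ p) ^+ _]exprNn [(- (y ^+ s) ^+ p) ^+ _]exprNn.
rewrite -[in X in _ = X * _ * _](subnK le_in) exprD exprMn.
by rewrite -!exprM !(mulnAC _ _ p); ring.
Qed.

End MonoPoly.

Lemma divn_modn_inj d a a' b b' : (b < d)%N -> (b' < d)%N ->
  (a * d + b = a' * d + b')%N -> a = a' /\ b = b'.
Proof.
move=> lt_b lt_b' eqab; have d_gt0 := leq_ltn_trans (leq0n b) lt_b; split.
  have := congr1 (divn^~ d) eqab.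
  by rewrite !divnMDl // !divn_small // !addn0.
by have := congr1 (modn^~ d) eqab; rewrite !modnMDl !modn_small.
Qed.

(** * The kernel of the Cartier operator *)

Section ExponentIndex.

Variables p s : nat.

(* The index ((i1, j1), (i0, j0)) stands for the exponents (i, j) of x and y
   through the divisions i = i1 p + i0 and j = j1 p + j0. *)
Local Notation index := (('I_s * 'I_s) * ('I_p * 'I_p))%type.

Definition xexp (q : index) : nat := q.1.1 * p + q.2.1.
Definition yexp (q : index) : nat := q.1.2 * p + q.2.2.

Lemma exp_inj (q q' : index) :
  xexp q = xexp q' -> yexp q = yexp q' -> q = q'.
Proof.
case: q q' => [[a b] [c e]] [[a' b'] [c' e']]; rewrite /xexp /yexp /=.
move=> /divn_modn_inj[] // /val_inj -> /val_inj ->.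
by move=> /divn_modn_inj[] // /val_inj -> /val_inj ->.
Qed.

Definition holo_index (q : index) := (xexp q + yexp q < s * p)%N.

Definition kernel_index (q : index) :=
  (q.1.1 + q.1.2 + 1 < s)%N && (p <= q.2.1 + q.2.2)%N.

(** When p <= i0 + j0 < 2p, the bound i + j < s p leaves room for at most s - 2 in i1 + j1, and any
    such value satisfies it. *)
Lemma kernel_indexE q :
  kernel_index q = holo_index q && (p <= q.2.1 + q.2.2)%N.
Proof.
rewrite /kernel_index /holo_index /xexp /yexp.
case: q => [[a b] [c e]] /=; have := ltn_ord c; have := ltn_ord e.
move: (a : nat) (b : nat) (c : nat) (e : nat) => {}a {}b {}c {}e lt_c lt_e.
case: (leqP p (c + e)) => [le_p|_]; rewrite ?andbF ?andbT //.
apply/idP/idP => [lt_ab|lt_k].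
  have : ((a + b + 2) * p <= s * p)%N by rewrite leq_mul2r; lia.
  by lia.
have : ((a + b + 1) * p < s * p)%N by lia.
by rewrite ltn_pmul2r // (leq_ltn_trans _ lt_c).
Qed.

End ExponentIndex.

Arguments holo_index {p s} q.

Section CartierKernelBasis.

Variables (K : closedFieldType) (p s : nat).
Hypotheses (hp : p \in [pchar K]) (s_gt0 : (0 < s)%N).

Local Notation k := (s * p)%N.
Local Notation F := (hurwitz K k.+1).

Variables (L : fieldType) (iota : {rmorphism K -> L}) (x y : L).
Hypothesis hL : function_field iota F x y.

Local Notation fY := (x ^+ k.+1 + y ^+ k).
Local Notation v := (x^-1).

Let p_gt0 : (0 < p)%N. Proof. exact/prime_gt0/pcharf_prime/hp. Qed.
Let hpL : p \in [pchar L]. Proof. exact: rmorph_pchar hp. Qed.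
Let k_gt0 : (0 < k)%N. Proof. by rewrite muln_gt0 s_gt0. Qed.

Local Notation index := (('I_s * 'I_s) * ('I_p * 'I_p))%type.

Definition comb (c : index -> K) : L :=
  \sum_q iota (c q) * (x ^+ xexp q * y ^+ yexp q).

Lemma form_value_comb g : form_value iota x y k.-1 g ->
  exists2 c, (forall q, ~~ holo_index q -> c q = 0) & g = comb c.
Proof.
pose T h := exists2 c, (forall q, ~~ holo_index q -> c q = 0) & h = comb c.
move=> [A hA ->]; rewrite hevalE big_seq; apply: (big_ind T).
- exists (fun=> 0) => //; rewrite /comb big1 // => q _.
  by rewrite rmorph0 mul0r.
- move=> _ _ [c hc ->] [c' hc' ->]; exists (fun q => c q + c' q).
    by move=> q hq; rewrite hc ?hc' ?addr0.
  by rewrite /comb -big_split; apply: eq_bigr => q _; rewrite rmorphD mulrDl.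
move=> m mA; have := dhomog_mf hA mA; rewrite /= mdeg3 => dm.
have lt_m : (m 0%R + m 1%R < k)%N.
  by rewrite -(prednK k_gt0) ltnS -dm leq_addr.
have lts a : (a < k)%N -> (a %/ p < s)%N by rewrite ltn_divLR.
have lt0 := leq_ltn_trans (leq_addr _ _) lt_m.
have lt1 := leq_ltn_trans (leq_addl _ _) lt_m.
pose q0 : index := ((Ordinal (lts _ lt0), Ordinal (lts _ lt1)),
  (Ordinal (ltn_pmod (m 0) p_gt0), Ordinal (ltn_pmod (m 1) p_gt0))).
have [xq0 yq0] : xexp q0 = m 0 /\ yexp q0 = m 1.
  by rewrite /xexp /yexp /= -!divn_eq.
exists (fun q => A@_m *+ (q == q0)) => [q|].
  by case: eqP => [->|//]; rewrite /holo_index xq0 yq0 lt_m.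
rewrite /comb (bigD1 q0) //= eqxx xq0 yq0 big1 ?addr0 // => q /negPf ->.
by rewrite mulr0n rmorph0 mul0r.
Qed.

Lemma comb_form_value c : (forall q, ~~ holo_index q -> c q = 0) ->
  form_value iota x y k.-1 (comb c).
Proof.
move=> hc; apply: form_value_sum => q _.
have [hq|hq] := boolP (holo_index q); last first.
  by rewrite hc // rmorph0 mul0r; apply: form_value0.
by apply/form_valueZ/form_value_monomial; rewrite -ltnS prednK.
Qed.

Lemma comb_eq0 c : (forall q, ~~ holo_index q -> c q = 0) -> comb c = 0 ->
  forall q, c q = 0.
Proof.
move=> hc; rewrite /comb (bigID holo_index) /= addrC.
rewrite big1 ?add0r => [sum0 q|q hq].
  have [hq|/hc//] := boolP (holo_index q).
  apply: (monomials_independent hL _ _ sum0) hq => [r hr|r r' _ _ [ex ey]].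
    exact: leqW (ltnW hr).
  exact: exp_inj.
by rewrite hc // rmorph0 mul0r.
Qed.

Definition comb_poly (c : index -> K) : {poly L} :=
  \sum_q (iota (c q) * (x ^+ q.1.1.+1 * y ^+ q.1.2.+1) ^+ p) *:
     mono_poly p s x y q.2.1 q.2.2.

Lemma comb_polyE c : comb c = (comb_poly c).[v] * (x * y)^-1.
Proof.
rewrite /comb_poly horner_sum mulr_suml; apply: eq_bigr => q _.
by rewrite hornerZ (mono_polyE hp hL) //; ring.
Qed.

Lemma ppower_comb_poly c : ppower_poly p (comb_poly c).
Proof.
apply: (ppower_poly_sum hp iota) => q _; rewrite -mul_polyC.
apply: (ppower_polyM hp iota) (ppower_mono_poly s hp iota _ _ _ _).
apply: (ppower_polyC hp iota); apply: ppowerM; first exact: (ppowerC hp).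
exact: ppowerX.
Qed.

Lemma size_comb_poly (c : index -> K) n :
    (forall q, c q != 0 -> ((p.-1 - q.2.1) + (p.-1 - q.2.2) < n)%N) ->
  (size (comb_poly c) <= n)%N.
Proof.
move=> hn; apply: leq_trans (size_sum _ _ _) _; apply/bigmax_leqP => q _.
have [->|/hn lt_n] := eqVneq (c q) 0.
  by rewrite rmorph0 mul0r scale0r size_poly0.
apply: leq_trans (size_scale_leq _ _) _.
exact: leq_trans (size_mono_poly _ _ _ _ _ _) lt_n.
Qed.

Variable D : L -> L^o.
Hypotheses (hD : derivation iota D) (Dx : D x = fY).

(* Each monomial outside the kernel contributes to the coefficient of v^(p-1)
   the p-th power of one monomial in x and y; these have distinct exponents and
   degree at most k + 1 < deg F. *)
Lemma exact_comb (c : index -> K) f : (forall q, ~~ holo_index q -> c q = 0) ->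
  D f = comb c -> forall q, ~~ kernel_index q -> c q = 0.
Proof.
move=> hc; rewrite comb_polyE -(derivation_inv_x hL hD Dx) => Df.
have := exact_coef_eq0 hp hL hD Dx (ppower_comb_poly c) _ Df.
have szc : (size (comb_poly c) <= p + p.-1)%N.
  apply: size_comb_poly => q _; have := p_gt0; lia.
move/(_ szc); rewrite coef_sum.
pose mc (q : index) : K := mono_coef K p q.2.1 q.2.2.
(* With p-th roots of the scalars, additivity of Frobenius gathers the whole sum into one p-th
   power. *)
pose g q : K := xchoose (exists_pth_root hp (c q * mc q)).
have gE q : g q ^+ p = c q * mc q.
  exact/eqP/(xchooseP (exists_pth_root hp _)).
pose al (q : index) := (q.1.1.+1 + s * (p.-1 - q.2.2 - q.2.1))%N.
pose be (q : index) := (q.1.2.+1 + s * q.2.1)%N.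
have -> : \sum_q ((iota (c q) * (x ^+ q.1.1.+1 * y ^+ q.1.2.+1) ^+ p) *:
     mono_poly p s x y q.2.1 q.2.2)`_p.-1 =
    (\sum_q iota (g q) * (x ^+ al q * y ^+ be q)) ^+ p.
  rewrite -(pFrobenius_autE hpL) rmorph_sum; apply: eq_bigr => q _.
  rewrite /= pFrobenius_autE [RHS]exprMn -(rmorphXn iota) gE coefZ.
  rewrite (coef_mono_poly _ hp iota) // rmorphM /al /be !exprD !exprMn.
  by move: (x ^+ (_ * _)) (y ^+ (_ * _)) => u w; ring.
move/eqP; rewrite expf_eq0 p_gt0 => /eqP sum0 q.
pose P (q : index) := holo_index q && (q.2.1 + q.2.2 < p)%N.
rewrite kernel_indexE negb_and -ltnNge => /orP[/hc//|lt_p].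
have [hq|/hc//] := boolP (holo_index q).
have g0 q' : ~~ P q' -> g q' = 0.
  rewrite negb_and -leqNgt => hq'; apply/eqP; rewrite -[_ == 0]andTb -p_gt0.
  rewrite -expf_eq0 gE; case/orP: hq' => [/hc->|le_p]; first by rewrite mul0r.
  by rewrite /mc mono_coef_eq0 ?mulr0.
rewrite (bigID P) /= [X in _ + X]big1 ?addr0 in sum0; last first.
  by move=> q' /g0 ->; rewrite rmorph0 mul0r.
have /eqP : g q ^+ p = 0.
  rewrite (monomials_independent hL _ _ sum0 (q := q)) ?expr0n ?gtn_eqF //.
  - move=> [[a b] [e e']] /andP[]; rewrite /holo_index /xexp /yexp /al /be /=.
    move: (a : nat) (b : nat) (e : nat) (e' : nat) => {}a {}b {}e {}e' hr lt_e.
    have : (a + b < s)%N by rewrite -(ltn_pmul2r p_gt0) mulnDl; lia.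
    have -> : (p.-1 - e' - e = p.-1 - (e' + e))%N by lia.
    have : (s * (p.-1 - (e' + e)) + s * e + s <= s * p)%N.
      by rewrite -mulnDr -mulnSr leq_mul2l; lia.
    by lia.
  (* Division by s recovers i1 and p - 1 - j0 - i0 from one exponent, j1 and i0 from the other. The
     subtraction is not truncated because i0 + j0 < p, so j0 follows. *)
  - move=> r r' /andP[_ lt_r] /andP[_ lt_r'] []; rewrite /al /be.
    have aux (a b a' b' : nat) : (a < s)%N -> (a' < s)%N ->
        (a + s * b = a' + s * b')%N -> a = a' /\ b = b'.
      move=> lt_a lt_a' eqab.
      by have [] := @divn_modn_inj s b b' a a' lt_a lt_a'; first by lia.
    move: lt_r lt_r'; case: r r' => [[a b] [e f']] [[a' b'] [e' f'']] /=.
    move=> lt_r lt_r' /aux[] // /val_inj -> eq1.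
    move=> /aux[] // /val_inj -> /val_inj eqe.
    by subst e'; congr (_, (_, _)); apply: val_inj => /=; lia.
  - by rewrite /P hq lt_p.
by rewrite gE mulf_eq0 (negPf (mono_coef_neq0 hp lt_p)) orbF => /eqP.
Qed.

End CartierKernelBasis.

Section KernelDimension.

Variables (K : closedFieldType) (p s : nat).
Hypotheses (hp : p \in [pchar K]) (s_gt0 : (0 < s)%N).

Local Notation k := (s * p)%N.
Local Notation F := (hurwitz K k.+1).

Variables (L : fieldType) (iota : {rmorphism K -> L}) (x y : L).
Hypothesis hL : function_field iota F x y.
Variables (Omega : lmodType L) (d : L -> Omega).
Hypothesis hd : kaehler iota d.

Local Notation fY := (x ^+ k.+1 + y ^+ k).
Local Notation w0 := (fY^-1 *: d x).
Local Notation index := (('I_s * 'I_s) * ('I_p * 'I_p))%type.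

Let p_gt0 : (0 < p)%N. Proof. exact/prime_gt0/pcharf_prime/hp. Qed.
Let hpL : p \in [pchar L]. Proof. exact: rmorph_pchar hp. Qed.
Let kK : k%:R = 0 :> K. Proof. by rewrite natrM (pcharf0 hp) mulr0. Qed.
Let k_gt0 : (0 < k)%N. Proof. by rewrite muln_gt0 s_gt0. Qed.

Lemma holomorphic_comb (c : index -> K) :
  (forall q, ~~ holo_index q -> c q = 0) ->
  holomorphic iota d F x y (comb iota x y c *: w0).
Proof.
move=> /(comb_form_value hp s_gt0 iota x y)[A hA ->].
exact: (holomorphic_form kK k_gt0 hL hd hA).
Qed.

(** On kernel indices the polynomial in v has degree at most p - 2, so it already is an expansion of
    the kind that [cartier] requires, with last coefficient zero. *)
Lemma cartier_comb (c : index -> K) :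
  (forall q, ~~ kernel_index q -> c q = 0) ->
  cartier d p (comb iota x y c *: w0) 0.
Proof.
move=> hc; have [D [hD Dx Dy _ dE]] := kaehler_generator kK hL hd.
have [u uE] : exists u : nat -> L,
    forall i, (comb_poly iota x y c)`_i = u i ^+ p.
  apply: functional_choice (fun i z => _ = z ^+ p) _.
  exact: (ppower_comb_poly hp).
have szc : (size (comb_poly iota x y c) <= p.-1)%N.
  apply: size_comb_poly => q cq.
  have /andP[_] : kernel_index q by apply: contraNT cq => /hc ->.
  have := ltn_ord q.2.1; have := ltn_ord q.2.2.
  by move: (q.2.1 : nat) (q.2.2 : nat) => a b; lia.
exists x^-1, u; split.
- exact: (inv_x_separating hp hL hD Dx).
- rewrite (comb_polyE hp hL) -(derivation_inv_x hL hD Dx) -scalerA -dE.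
  congr (_ *: _); rewrite (@horner_coef_wide _ p) ?(leq_trans szc) ?leq_pred //.
  by apply: eq_bigr => i _; rewrite uE.
- have /eqP := uE p.-1.
  rewrite nth_default // eq_sym expf_eq0 => /andP[_ /eqP->].
  by rewrite scale0r.
Qed.

Lemma kernel_comb omega :
    holomorphic iota d F x y omega -> cartier d p omega 0 ->
  exists2 c : index -> K, (forall q, ~~ kernel_index q -> c q = 0)
    & omega = comb iota x y c *: w0.
Proof.
have [D [hD Dx Dy w0_neq0 dE]] := kaehler_generator kK hL hd.
move=> /(holomorphic_form_value kK k_gt0 hL hd)[g /(form_value_comb hp s_gt0)].
move=> [c hc ->] ->; set w := w0 in w0_neq0 dE *.
move=> /(cartier_exact hpL (proj1 hd))[f]; rewrite dE => /eqP.
rewrite -subr_eq0 -scalerBl scaler_eq0 (negPf w0_neq0) orbF subr_eq0.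
move=> /eqP/esym Df; exists c => //.
exact: (exact_comb hp s_gt0 hL hD Dx hc Df).
Qed.

Lemma a_number_card :
  a_number iota d p F x y #|[set q : index | kernel_index q]|.
Proof.
set S := [set q | _].
pose e (i : 'I_#|S|) : Omega :=
  (x ^+ xexp (enum_val i) * y ^+ yexp (enum_val i)) *: w0.
have combE (c : index -> K) : (forall q, ~~ kernel_index q -> c q = 0) ->
    comb iota x y c *: w0 = \sum_(i < #|S|) iota (c (enum_val i)) *: e i.
  move=> hc; rewrite /comb (bigID (mem S)) /= [X in _ + X]big1 ?addr0;
    last by move=> q; rewrite inE => /hc ->; rewrite rmorph0 mul0r.
  rewrite big_enum_val scaler_suml; apply: eq_bigr => i _.
  by rewrite /e [RHS]scalerA.
have extend (c : 'I_#|S| -> K) : exists2 c' : index -> K,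
    forall q, ~~ kernel_index q -> c' q = 0 & forall i, c' (enum_val i) = c i.
  (* Extension by zero: the sum runs over a fibre of [enum_val], which has at most one element. *)
  exists (fun q => \sum_(i | enum_val i == q) c i) => [q hq|i].
    rewrite big1 // => i /eqP eqq; move: hq; rewrite -eqq.
    by have := enum_valP i; rewrite inE => ->.
  by rewrite (big_pred1 i) // => j; rewrite (inj_eq enum_val_inj).
have kernel_holo q : ~~ holo_index q -> ~~ kernel_index q.
  by rewrite kernel_indexE; apply: contraNN => /andP[].
exists e; split=> [omega|c sum0 i].
  split=> [[hol car]|[c ->]].
    have [c hc ->] := kernel_comb hol car.
    by exists (c \o enum_val); apply: combE.
  have [c' hc' cE] := extend c.
  have -> : \sum_(i < #|S|) iota (c i) *: e i = comb iota x y c' *: w0.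
    by rewrite combE //; apply: eq_bigr => i _; rewrite cE.
  split; last exact: cartier_comb.
  by apply: holomorphic_comb => q /kernel_holo/hc'.
have [c' hc' cE] := extend c; rewrite -cE.
have [_ [_ _ _ w0_neq0 _]] := kaehler_generator kK hL hd.
apply: (comb_eq0 hL) => [q /kernel_holo/hc'//|].
have /eqP : comb iota x y c' *: w0 = 0.
  by rewrite combE // -[RHS]sum0; apply: eq_bigr => j _; rewrite cE.
by rewrite scaler_eq0 (negPf w0_neq0) orbF => /eqP.
Qed.

End KernelDimension.

(** * Counting the kernel exponents *)

Lemma card_pairs_ge m :
  #|[set u : 'I_m * 'I_m | (m <= u.1 + u.2)%N]| = 'C(m, 2).
Proof.
rewrite -bin2_sum big_mkord -sum1_card.
rewrite (eq_bigl (fun u : 'I_m * 'I_m => (m <= u.1 + u.2)%N)); last first.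
  by move=> u; rewrite inE.
rewrite -(pair_big_dep xpredT (fun a b : 'I_m => (m <= a + b)%N)
  (fun _ _ => 1%N)) /=.
(* For fixed a the admissible b are the last a elements of ['I_m], reached from ['I_a] by
   reversal. *)
apply: eq_bigr => a _; rewrite sum1_card -[RHS]card_ord.
have le_am : (a <= m)%N by apply/ltnW/ltn_ord.
rewrite -(card_imset _
  (_ : injective (fun i : 'I_a => rev_ord (widen_ord le_am i)))).
  apply: eq_card => b; apply/idP/imsetP => [|[i _ ->]].
    rewrite unfold_in => le_m.
    have lt_b : (rev_ord b < a)%N by rewrite /=; have := ltn_ord b; lia.
    exists (Ordinal lt_b) => //; rewrite -[LHS]rev_ordK; congr rev_ord.
    exact: val_inj.
  rewrite unfold_in /=; have := ltn_ord i; have := ltn_ord a; lia.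
by move=> i j /rev_ord_inj/(congr1 val) /= /val_inj.
Qed.

Lemma card_pairs_lt m :
  #|[set u : 'I_m * 'I_m | (u.1 + u.2 + 1 < m)%N]| = 'C(m, 2).
Proof.
(* Reversing both coordinates replaces the sum by 2(m - 1) minus itself, exchanging sums at most m -
   2 with sums at least m. *)
pose f (u : 'I_m * 'I_m) := (rev_ord u.1, rev_ord u.2).
have fK : involutive f by case=> a b; rewrite /f /= !rev_ordK.
rewrite -card_pairs_ge -(card_imset _ (inv_inj fK)); apply: eq_card => u.
have memf (A : {set 'I_m * 'I_m}) : (u \in [set f z | z in A]) = (f u \in A).
  by rewrite -{1}[u]fK mem_imset //; apply: inv_inj.
rewrite memf !inE /=; case: u {memf} => a b /=.
by have := ltn_ord a; have := ltn_ord b; lia.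
Qed.

Lemma card_kernel_index p s :
  #|[set q : ('I_s * 'I_s) * ('I_p * 'I_p) | kernel_index q]|
    = ('C(s, 2) * 'C(p, 2))%N.
Proof.
rewrite -card_pairs_lt -card_pairs_ge -cardsX; apply: eq_card => q.
by rewrite !inE.
Qed.

Lemma natr_bin2 m : 'C(m, 2)%:R = 2^-1 * m%:R * (m%:R - 1) :> rat.
Proof.
case: m => [|m]; first by rewrite mulr0 mul0r.
have := bin_ffact m.+1 2; rewrite !ffactnS ffactn0 muln1 /= => eqC.
have : ('C(m.+1, 2) * 2)%:R = (m.+1 * m)%:R :> rat by rewrite -eqC.
by rewrite !natrM -[m.+1%:R]natr1; lra.
Qed.

Theorem theorem4p7 (K : closedFieldType) (p : nat) (hp : p \in [pchar K])
    (s : nat) (hs : (1 <= s)%N)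
    (L : fieldType) (iota : {rmorphism K -> L}) (x y : L)
    (hL : function_field iota (hurwitz K (s * p + 1)) x y)
    (Omega : lmodType L) (d : L -> Omega) (hd : kaehler iota d) :
  exists a : nat,
    a_number iota d p (hurwitz K (s * p + 1)) x y a /\
    (a%:R = 4^-1 * s%:R * (s%:R - 1) * p%:R * (p%:R - 1) :> rat).
Proof.
rewrite addn1 in hL *; exists ('C(s, 2) * 'C(p, 2))%N; split.
  by rewrite -card_kernel_index; apply: a_number_card.
by rewrite natrM !natr_bin2; field.
Qed.
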